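(* Let $G$ be a connected semisimple linear algebraic group over an algebraically closed field $\mathbb{K}$ (of arbitrary characteristic), $T$ a maximal torus of $G$, $r=\dim T$, and $W=N_G(T)/T$ the Weyl group. Let $w\in W$, let $N_w$ be the connected component of $N_G(T)$ corresponding to $w$, and let $m(w)$ be the multiplicity of $w$. For a positive integer $k$, let $D_k(w)$ be the set of elements of order $k$ in $N_w$. Then $D_k(w)$ is: a) empty if $d(w)$ does not divide $k$; b) a disjoint union of $m(w)\,\nu(s,\sigma(w))$ irreducible closed subvarieties $C_i$ if $d(w)=\mathrm{ord}(w)$ and $k=d(w)s$; c) a disjoint union of irreducible closed subvarieties $C_i$ if $d(w)=2\cdot\mathrm{ord}(w)$ and $k=d(w)s$, where the number of such subvarieties is $m(w)\bigl(\nu(s,\sigma(w))+\nu(2s,\sigma(w))\bigr)$ for odd $s$ and $m(w)\,\nu(2s,\sigma(w))$ for even $s$. Each subvariety $C_i$ is isomorphic (as a variety) to a torus of dimension $r-\sigma(w)$ and is an orbit of the action of $T$ on $N_w$ by conjugation.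
   Context: Notation. The identity component of $N_G(T)$ is $T$, and for $w\in W$ the component $N_w$ is the coset of $T$ in $N_G(T)$ representing $w$; fix $n_w\in N_w$, so $N_w=n_wT=Tn_w$. Let $\varphi_w\colon T\to T$, $\varphi_w(t)=n_wtn_w^{-1}$ (independent of the choice of $n_w\in N_w$). Let $M$ be the character lattice of $T$ and $M_{\mathbb{Q}}=M\otimes_{\mathbb{Z}}\mathbb{Q}$; $W$ acts on $M_{\mathbb{Q}}$ through the automorphisms $\varphi_w$ (the standard linear representation). The number $\sigma(w)$ is the dimension of the subspace of $w$-fixed vectors in $M_{\mathbb{Q}}$. $\mathrm{ord}(w)$ is the order of $w$ in $W$, and $d(w)$ is the smallest order of elements of $N_w$; it is known that $d(w)$ equals $\mathrm{ord}(w)$ or $2\cdot\mathrm{ord}(w)$. $\nu(k,q)$ denotes the number of elements of order exactly $k$ in a torus $(\mathbb{K}^{\times})^q$ of dimension $q$ over $\mathbb{K}$ (so $\nu(1,q)=1$ for all $q$, $\nu(k,0)=0$ for $k\ge 2$, and $\nu(k,q)=0$ if $k$ is divisible by $\mathrm{char}\,\mathbb{K}=p>0$). A disjoint union of $0$ subvarieties is the empty set. Multiplicity. An integer matrix $C=(c_{ij})$ of size $k\times m$ defines the homomorphism of tori $\gamma_C\colon(\mathbb{K}^{\times})^k\to(\mathbb{K}^{\times})^m$, $(t_1,\ldots,t_k)\mapsto(t_1^{c_{11}}\cdots t_k^{c_{k1}},\ldots,t_1^{c_{1m}}\cdots t_k^{c_{km}})$, and the multiplicity of $C$ is the number of connected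 components of $\ker\gamma_C$. Let $\Phi_w$ be the matrix, in some basis of $M$, of the linear map $M\to M$, $\chi\mapsto\chi\circ\varphi_w$, and let $E$ be the identity matrix. The multiplicity $m(w)$ of $w\in W$ is the multiplicity of the matrix $B_w=E+\Phi_w+\ldots+\Phi_w^{d-1}$, where $d=\mathrm{ord}(w)$. Equivalently, $m(w)$ is the number of connected components of the kernel of the homomorphism $T\to T$, $t\mapsto t\,\varphi_w(t)\cdots\varphi_w^{d-1}(t)$. *)

(* Defs.v *)
From HB Require Import structures.
From mathcomp Require Import all_boot all_order all_algebra.
From mathcomp Require Import finmap.
From mathcomp Require Import boolp classical_sets functions cardinality.
From mathcomp Require Import topology.
From mathcomp Require mpoly.
Import -(notations) mpoly.

Set Implicit Arguments.
Unset Strict Implicit.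
Unset Printing Implicit Defensive.

Import GRing.Theory.

Local Open Scope classical_set_scope.
Local Open Scope ring_scope.

(* least and ncard take the junk value 0 when the set is empty, resp. infinite. *)
Definition least (P : set nat) : nat :=
  xget 0%N [set k | P k /\ forall j, P j -> (k <= j)%N].

Definition ncard (T : choiceType) (A : set T) : nat := #|` fset_set A|%fset.

Record GL (K : closedFieldType) (n : nat) :=
  MkGL { glval :> 'M[K]_n; glvalP : glval \in unitmx }.

HB.instance Definition _ (K : closedFieldType) (n : nat) :=
  [isSub for @glval K n].
HB.instance Definition _ (K : closedFieldType) (n : nat) :=
  [Choice of GL K n by <:].

Section GLGroup.
Variables (K : closedFieldType) (n : nat).
Implicit Types x y z : GL K n.

Fact gl1_subproof : (1%:M : 'M[K]_n) \in unitmx.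
Proof. exact: unitmx1. Qed.

Fact glM_subproof x y : (x : 'M[K]_n) *m y \in unitmx.
Proof. by rewrite unitmx_mul !glvalP. Qed.

Fact glV_subproof x : invmx (x : 'M[K]_n) \in unitmx.
Proof. by rewrite unitmx_inv glvalP. Qed.

Definition gl1 : GL K n := MkGL gl1_subproof.
Definition glM x y : GL K n := MkGL (glM_subproof x y).
Definition glV x : GL K n := MkGL (glV_subproof x).

Fact glMA : associative glM.
Proof. by move=> x y z; apply: val_inj; rewrite /= mulmxA. Qed.

Fact gl1M : left_id gl1 glM.
Proof. by move=> x; apply: val_inj; rewrite /= mul1mx. Qed.

Fact glM1 : right_id gl1 glM.
Proof. by move=> x; apply: val_inj; rewrite /= mulmx1. Qed.

Fact glVM : left_inverse gl1 glV glM.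
Proof. by move=> x; apply: val_inj; rewrite /= mulVmx ?glvalP. Qed.

Fact glMV : right_inverse gl1 glV glM.
Proof. by move=> x; apply: val_inj; rewrite /= mulmxV ?glvalP. Qed.

HB.instance Definition _ := isGroup.Build (GL K n) glMA gl1M glM1 glVM glMV.

End GLGroup.

Section Zariski.
Variables (K : closedFieldType) (n : nat).

Local Notation polyE := (mpoly (n * n) K).

Definition entries (x : 'M[K]_n) : 'I_(n * n) -> K := mxvec x ord0.

Definition zeros (P : set polyE) : set (GL K n) :=
  [set x | forall p, P p -> meval (entries x) p = 0].

Definition zariski_open : set_system (GL K n) :=
  [set U | exists P, U = ~` zeros P].

Fact zariski_openT : zariski_open setT.
Proof.
exists [set (1 : polyE)]; apply/seteqP; split=> // x _ /(_ 1 erefl) /eqP.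
by rewrite meval1 oner_eq0.
Qed.

Fact zariski_openI : setI_closed zariski_open.
Proof.
move=> _ _ [P ->] [Q ->]; exists [set p * q | p in P & q in Q].
rewrite -setCU; congr (~` _); apply/seteqP; split=> [x Hx r|x Hx].
  case=> p Pp [q Qq <-]; rewrite mevalM.
  by case: Hx => [/(_ _ Pp)|/(_ _ Qq)] ->; rewrite ?mul0r ?mulr0.
have [?|/existsNP[p /not_implyP[Pp /eqP p0]]] := pselect (zeros P x).
  by left.
right=> q Qq; apply/eqP; have /eqP : meval (entries x) (p * q) = 0.
  by apply: Hx; exists p => //; exists q.
by rewrite mevalM mulf_eq0 (negPf p0).
Qed.

Fact zariski_open_bigU (I : Type) (f : I -> set (GL K n)) :
  (forall i, zariski_open (f i)) -> zariski_open (\bigcup_i f i).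
Proof.
move=> /choice[P fP]; exists (\bigcup_i P i); rewrite -[LHS]setCK setC_bigcup.
congr (~` _); apply/seteqP; split=> [x Hx p [i _ Pp]|x Hx i _].
  by have := Hx i Logic.I; rewrite fP setCK; apply.
by rewrite fP setCK => p Pp; apply: Hx; exists i.
Qed.

HB.instance Definition _ := isOpenTopological.Build (GL K n)
  zariski_openT zariski_openI zariski_open_bigU.

Lemma zariski_closedE (X : set (GL K n)) :
  closed X <-> exists P, X = zeros P.
Proof.
rewrite -openC; split=> [[P /(congr1 (@setC _))]|[P ->]].
  by rewrite !setCK; exists P.
by exists P.
Qed.

Definition irreducible_set (X : set (GL K n)) :=
  X !=set0 /\ forall A B : set (GL K n), closed A -> closed B ->
    X `<=` A `|` B -> X `<=` A \/ X `<=` B.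

(* K[GL_n] is generated by the matrix entries and 1/det, and regular functions
   on a closed subset of the affine variety GL_n are restrictions. *)
Definition regular (X : set (GL K n)) (f : GL K n -> K) :=
  exists (p : polyE) (e : nat), forall x, X x ->
    f x = meval (entries x) p / \det x ^+ e.

End Zariski.

Definition morphism_var (K : closedFieldType) (n m : nat)
    (X : set (GL K n)) (Y : set (GL K m)) (f : GL K n -> GL K m) :=
  (forall x, X x -> Y (f x)) /\ forall i j, regular X (fun x => f x i j).

Definition iso_var_by (K : closedFieldType) (n m : nat)
    (X : set (GL K n)) (Y : set (GL K m)) (f : GL K n -> GL K m) :=
  morphism_var X Y f /\
  exists g : GL K m -> GL K n, [/\ morphism_var Y X g,
    forall x, X x -> g (f x) = x & forall y, Y y -> f (g y) = y].

Definition iso_var (K : closedFieldType) (n m : nat)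
    (X : set (GL K n)) (Y : set (GL K m)) := exists f, iso_var_by X Y f.

Definition iso_grp (K : closedFieldType) (n m : nat)
    (X : set (GL K n)) (Y : set (GL K m)) :=
  exists f, iso_var_by X Y f /\
    forall x y, X x -> X y -> f (x * y)%g = (f x * f y)%g.

(* The torus of dimension q, as the closed subgroup of diagonal matrices. *)
Definition Gm (K : closedFieldType) (q : nat) : set (GL K q) :=
  [set t | is_diag_mx (t : 'M[K]_q)].
Arguments Gm : clear implicits.

Section Groups.
Variables (K : closedFieldType) (n : nat).
Implicit Types G H T : set (GL K n).

Definition subgroup H := group_closed (mem H).

Definition algebraic_group H := closed H /\ subgroup H.

Definition derived H : set (GL K n) :=
  smallest subgroup [set [~ x, y]%g | x in H & y in H].

Definition solvable_group H := exists k, iter k derived H = [set 1%g].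

Definition normal_in H G :=
  H `<=` G /\ forall g h, G g -> H h -> H (h ^ g)%g.

(* The radical, i.e. the largest connected solvable normal closed subgroup,
   is trivial. *)
Definition trivial_radical G := forall H, algebraic_group H -> normal_in H G ->
  connected H -> solvable_group H -> H = [set 1%g].

Definition connected_semisimple G :=
  [/\ algebraic_group G, connected G & trivial_radical G].

Definition torus_of_dim (q : nat) T := algebraic_group T /\ iso_grp T (Gm K q).

Definition is_torus T := exists q, torus_of_dim q T.

Definition maximal_torus G T :=
  [/\ is_torus T, T `<=` G &
      forall T', is_torus T' -> T' `<=` G -> T `<=` T' -> T' = T].

Definition normalizer G T : set (GL K n) :=
  [set g | G g /\ [set (t ^ g)%g | t in T] = T].

(* An element w of the Weyl group N_G(T)/T is a coset of T, so that the
   component N_w of N_G(T) is w itself. *)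
Definition weyl G T : set (set (GL K n)) :=
  [set [set (g * t)%g | t in T] | g in normalizer G T].

Definition coset_mul (A B : set (GL K n)) : set (GL K n) :=
  [set (a * b)%g | a in A & b in B].

Definition coset_pow T (w : set (GL K n)) (k : nat) : set (GL K n) :=
  iter k (coset_mul w) T.

Definition order_weyl T w : nat :=
  least [set k | (0 < k)%N /\ coset_pow T w k = T].

Definition order_elt (x : GL K n) : nat :=
  least [set k | (0 < k)%N /\ (x ^+ k = 1)%g].

Definition min_order (w : set (GL K n)) : nat :=
  least [set k | (0 < k)%N /\ exists2 x, w x & order_elt x = k].

Definition elts_of_order (k : nat) (w : set (GL K n)) : set (GL K n) :=
  [set x | w x /\ order_elt x = k].

Definition phi (w : set (GL K n)) (t : GL K n) : GL K n :=
  let nw := xget 1%g w in (nw * t * nw^-1)%g.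

Definition character T (chi : GL K n -> K) :=
  [/\ regular T chi, forall t, T t -> chi t != 0 &
      forall s t, T s -> T t -> chi (s * t)%g = chi s * chi t].

(* Characters are functions on T extended arbitrarily to GL_n, hence are
   compared on T only. *)
Definition char_basis T (r : nat) (chi : 'I_r -> GL K n -> K) :=
  (forall i, character T (chi i)) /\
  forall psi, character T psi -> exists! a : 'cV[int]_r,
    forall t, T t -> psi t = \prod_i chi i t ^ a i ord0.

(* Column j holds the coordinates of the image of the j-th basis character. *)
Definition pullback_matrix T w (r : nat) (P : 'M[int]_r) :=
  exists2 chi, char_basis T chi &
    forall j t, T t -> chi j (phi w t) = \prod_i chi i t ^ P i j.

(* The matrix of chi |-> chi \o phi_w in some basis of the character lattice. *)
Definition Phi T (r : nat) w : 'M[int]_r := xget 0 (pullback_matrix T w (r := r)).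

(* M_Q is Q^r through the chosen basis, w acting on column vectors by Phi_w,
   whereas eigenspace is about row vectors. *)
Definition sigma T (r : nat) w : nat :=
  \rank (eigenspace (map_mx (intr : int -> rat) (Phi T r w))^T 1).

End Groups.

Definition gamma (K : closedFieldType) (k m : nat) (C : 'M[int]_(k, m))
    (t : GL K k) : 'rV[K]_m := \row_j \prod_i t i i ^ C i j.

Definition ker_gamma (K : closedFieldType) (k m : nat) (C : 'M[int]_(k, m)) :
    set (GL K k) := [set t | Gm K k t /\ gamma C t = const_mx 1].
Arguments ker_gamma : clear implicits.

Definition multiplicity_mx (K : closedFieldType) (k m : nat)
    (C : 'M[int]_(k, m)) : nat :=
  ncard (connected_component (ker_gamma K k m C) @` ker_gamma K k m C).
Arguments multiplicity_mx : clear implicits.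

Definition multiplicity (K : closedFieldType) (n : nat) (T : set (GL K n))
    (r : nat) (w : set (GL K n)) : nat :=
  multiplicity_mx K r r (\sum_(i < order_weyl T w) Phi T r w ^+ i).

Definition nu (K : closedFieldType) (k q : nat) : nat :=
  ncard [set t : GL K q | Gm K q t /\ order_elt t = k].

Definition orbit_decomposition (K : closedFieldType) (n : nat)
    (T w D : set (GL K n)) (N q : nat) :=
  exists C : 'I_N -> set (GL K n),
    [/\ D = \bigcup_i C i, trivIset setT C &
        forall i, [/\ irreducible_set (C i), closed (C i),
          iso_var (C i) (Gm K q) &
          exists2 x, w x & C i = [set (t * x * t^-1)%g | t in T]]].

(* Main.v *)
Require Import Defs.
From mathcomp Require Import all_boot all_order all_algebra finmap.
From mathcomp Require Import boolp classical_sets functions cardinality topology.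
From mathcomp Require mpoly.
Import -(notations) mpoly.
Import GRing.Theory.
Set Implicit Arguments.
Unset Strict Implicit.
Unset Printing Implicit Defensive.

(** The characters of a diagonal torus are monomials ([Gm_character_monomial]).
    So a basis of the character lattice identifies T with the diagonal torus of
    dimension r, and conjugation by w with the monomial map of an integer matrix
    P ([Phi_chart]) such that P ^+ d = 1, where d is the order of w ([period]).
    Write w(t) for the image of t under this map.  For x in the coset w and
    t in T one has (t x) ^+ d = N(t) x ^+ d, where N is the norm, the monomial
    map of B = 1 + P + ... + P ^+ d.-1, and s (t x) s^-1 = (s w(s)^-1) t x.
    Everything follows from comparing the two homomorphisms N and
    s |-> s w(s)^-1, the latter with matrix 1 - P.

    Over the rationals B / d is the projection onto the w-invariants, so B has
    rank sigma(w) and 1 - P has rank r - sigma(w) ([rank_norm]).  By the Smith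
    normal form ([int_image_factor]) the image of a monomial map of rank rho is
    a direct factor of the torus, a torus of dimension rho.  Hence the
    T-orbits in w are the cosets of a torus H of dimension r - sigma(w), and
    the image of N is a torus of dimension sigma(w).  As (1 - P) B = 0, the
    torus H lies in the kernel of N; a complement of H meets this kernel in
    d-torsion, so H has finite index there, and its cosets, being irreducible
    and closed, are the connected components of the kernel: their number is
    m(w) ([kernel_component], [enumerates_kernel_reps]).  The set of t x with
    N(t) in a set of N0 elements of the image of N is therefore a disjoint
    union of m(w) N0 orbits, each of them a translate of H, whence closed,
    irreducible and isomorphic to H ([fiber_decomposition]).

    It remains to read the order of t x off N(t).  All orders in w are
    multiples of d.  If x has order d, then t x has order d s exactly when
    N(t) has order s ([coset_exp_eq1]), which gives b).  If x has order 2 d and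
    no element of w has order d, then z = x ^+ d is an involution outside the
    image of N: otherwise z = N(t)^-1 for some t, and then (t x) ^+ d = 1
    ([kill_power]).  So (t x) ^+ (d q) = 1 exactly when q is even and
    N(t) ^+ q = 1, and lcm(2, ord N(t)) = 2 s means that N(t) has order 2 s, or
    order s with s odd ([order_even_power]); this gives c).  The argument of
    [kill_power] gives a) as well: if x has minimal order and y in w satisfies
    y ^+ k = 1, then the remainder of k modulo the order of x is an exponent
    killing some element of w, so it is zero ([min_order_dvd]). *)

Local Open Scope classical_set_scope.
Local Open Scope ring_scope.

(** * Counting and orders *)

Definition enumerates (T : Type) N (e : 'I_N -> T) (A : set T) :=
  injective e /\ forall x, A x <-> exists i, e i = x.

Lemma enumerates_ncard (T : choiceType) N (e : 'I_N -> T) A :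
  enumerates e A -> ncard A = N.
Proof.
move=> [einj eA]; rewrite /ncard.
have Afin : finite_set A.
  apply: (@sub_finite_set _ _ (e @` setT)); last exact/finite_image/finite_finset.
  by move=> x /eA[i <-]; exists i.
have -> : N = size (map e (enum 'I_N)) by rewrite size_map -cardT card_ord.
apply: (@perm_size _ (enum_fset (fset_set A))); apply: uniq_perm.
- exact: fset_uniq.
- by rewrite map_inj_uniq ?enum_uniq.
move=> x; rewrite in_fset_set //; apply/idP/mapP => [|[i _ ->]].
  by rewrite inE => /eA[i <-]; exists i; rewrite ?mem_enum.
by rewrite inE; apply/eA; exists i.
Qed.

Lemma finite_enumerates (T : choiceType) (A : set T) :
  finite_set A -> exists e : 'I_(ncard A) -> T, enumerates e A.
Proof.
move=> Afin; exists (tnth (in_tuple (fset_set A))); split.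
  by apply/tuple_uniqP; apply: fset_uniq.
move=> x; rewrite -[A in A x]fset_setK //.
split=> [/= xA|[i <-]]; last exact: mem_tnth.
by have /(@tnthP _ _ (in_tuple (fset_set A)))[i ->] := xA; exists i.
Qed.

Lemma enumeratesU (T : Type) N1 N2 (e1 : 'I_N1 -> T) (e2 : 'I_N2 -> T) A B :
  enumerates e1 A -> enumerates e2 B -> (forall x, A x -> B x -> False) ->
  exists e : 'I_(N1 + N2) -> T, enumerates e (A `|` B).
Proof.
move=> [i1 A1] [i2 B2] AB.
have e1A i : A (e1 i) by apply/A1; exists i.
have e2B i : B (e2 i) by apply/B2; exists i.
exists (fun i => match fintype.split i with inl j => e1 j | inr j => e2 j end); split.
  move=> i j eij; apply: (can_inj (@splitK _ _)); move: eij.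
  case: (fintype.split i) => a; case: (fintype.split j) => b eij.
  - by rewrite (i1 _ _ eij).
  - by case: (AB (e1 a)) => //; rewrite eij.
  - by case: (AB (e1 b)) => //; rewrite -eij.
  - by rewrite (i2 _ _ eij).
move=> x; split=> [[/A1[i <-]|/B2[i <-]]|[i <-]].
- by exists (unsplit (inl i)); rewrite unsplitK.
- by exists (unsplit (inr i)); rewrite unsplitK.
- by case: (fintype.split i) => a; [left|right].
Qed.

Lemma leastP (P : set nat) :
  (exists k, P k) -> P (least P) /\ forall j, P j -> (least P <= j)%N.
Proof.
move=> exP; rewrite /least; case: xgetP => [k -> []//|noP]; exfalso.
have exbP : exists k, `[<P k>] by have [k Pk] := exP; exists k; exact/asboolP.
have [k Pk kmin] := ex_minnP exbP.
by apply: (noP k); split=> [|j Pj]; [exact/asboolP|apply: kmin; exact/asboolP].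
Qed.

Lemma least_gt0 (P : set nat) : (0 < least P)%N ->
  P (least P) /\ forall j, P j -> (least P <= j)%N.
Proof. by rewrite /least; case: xgetP => // k -> []. Qed.

Lemma order_eltP (K : closedFieldType) n (x : GL K n) k : (0 < k)%N ->
  order_elt x = k <-> forall j, (x ^+ j)%g = 1%g <-> (k %| j)%N.
Proof.
move=> k0; split=> [xk j|xk].
  have [] := @least_gt0 [set k | (0 < k)%N /\ (x ^+ k = 1)%g].
    by rewrite -/(order_elt x) xk.
  rewrite -/(order_elt x) xk => -[_ xk1] kmin.
  split=> [xj|/dvdnP[q ->]]; last by rewrite mulnC expgnA xk1 expg1n.
  rewrite /dvdn -leqn0 leqNgt; apply/negP => jk.
  suff: (k <= j %% k)%N by rewrite leqNgt ltn_mod k0.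
  apply: kmin; split=> //.
  by move: xj; rewrite {1}(divn_eq j k) expgnDr mulnC expgnA xk1 expg1n mul1g.
have [] := @leastP [set k | (0 < k)%N /\ (x ^+ k = 1)%g].
  by exists k; split=> //; apply/xk.
rewrite /order_elt; move: (least _) => o [o0 xo] omin.
apply/anti_leq/andP; split; last by apply: dvdn_leq => //; apply/xk.
by apply: omin; split=> //; apply/xk.
Qed.

Lemma order_elt_fin (K : closedFieldType) n (x : GL K n) k : (0 < k)%N ->
  (x ^+ k)%g = 1%g -> (0 < order_elt x)%N /\
  forall j, (x ^+ j)%g = 1%g <-> (order_elt x %| j)%N.
Proof.
move=> k0 xk; have [] := @leastP [set k | (0 < k)%N /\ (x ^+ k = 1)%g].
  by exists k.
rewrite -/(order_elt x) => -[o0 _] _; split=> //.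
exact/(order_eltP x o0).
Qed.

Lemma order_elt_eq0 (K : closedFieldType) n (x : GL K n) k : (0 < k)%N ->
  order_elt x = k -> (x ^+ k)%g = 1%g.
Proof. by move=> k0 /(order_eltP _ k0)/(_ k)->. Qed.

(** The left-hand side says that lcm(2, ord v) = 2 s; the two cases on the right
    are those of an even and of an odd order of v. *)
Lemma order_even_power (K : closedFieldType) n (v : GL K n) s : (0 < s)%N ->
  (forall q, ((2 %| q)%N /\ (v ^+ q)%g = 1%g) <-> (2 * s %| q)%N) <->
  order_elt v = (2 * s)%N \/ (odd s /\ order_elt v = s).
Proof.
move=> s0; have s20 : (0 < 2 * s)%N by rewrite muln_gt0.
have reduce : (v ^+ (2 * s))%g = 1%g ->
    (forall q, ((2 %| q)%N /\ (v ^+ q)%g = 1%g) <-> (2 * s %| q)%N) <->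
    lcmn 2 (order_elt v) = (2 * s)%N.
  move=> v2s; have [o0 oP] := order_elt_fin s20 v2s; split=> [h|h q].
    apply/eqP; rewrite eqn_dvd; apply/andP; split.
      by rewrite dvdn_lcm dvdn_mulr //=; apply/oP.
    by apply/h; split; [exact: dvdn_lcml|apply/oP; exact: dvdn_lcmr].
  rewrite -h dvdn_lcm; split=> [[-> /oP->]//|/andP[? ?]]; split=> //.
  exact/oP.
split=> [h|h].
  have v2s : (v ^+ (2 * s))%g = 1%g by have /h[] := dvdnn (2 * s)%N.
  have := (reduce v2s).1 h; have [o0 _] := order_elt_fin s20 v2s.
  have [oo|oe] := boolP (odd (order_elt v)); last first.
    by rewrite (lcmn_idPr _) ?dvdn2 // => ->; left.
  rewrite -[lcmn _ _]muln1 -[X in (_ * X)%N](_ : gcdn 2 (order_elt v) = 1)%N.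
    rewrite muln_lcm_gcd => /eqP; rewrite eqn_pmul2l // => /eqP os.
    by right; rewrite -os.
  by apply/eqP; rewrite -/(coprime _ _) coprime2n.
have v2s : (v ^+ (2 * s))%g = 1%g.
  case: h => [|[_]] h; first exact: order_elt_eq0 h.
  by rewrite mulnC expgnA (order_elt_eq0 s0 h) expg1n.
apply/(reduce v2s); case: h => [->|[so ->]].
  by apply/lcmn_idPr; rewrite dvdn_mulr.
rewrite -[lcmn _ _]muln1 -[X in (_ * X)%N](_ : gcdn 2 s = 1)%N ?muln_lcm_gcd //.
by apply/eqP; rewrite -/(coprime _ _) coprime2n.
Qed.

(** * Regular functions and regular maps *)

Lemma glvalM (K : closedFieldType) n (x y : GL K n) :
  glval (x * y)%g = glval x *m glval y.
Proof. by []. Qed.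

Lemma glvalV (K : closedFieldType) n (x : GL K n) :
  glval (x^-1)%g = invmx (glval x).
Proof. by []. Qed.

Lemma glval1 (K : closedFieldType) n : glval (1%g : GL K n) = 1%:M.
Proof. by []. Qed.

Lemma det_gl_neq0 (K : closedFieldType) n (x : GL K n) : \det x != 0.
Proof. by have := glvalP x; rewrite unitmxE unitfE. Qed.

Section RegularRing.
Variables (K : closedFieldType) (n : nat).
Implicit Types (X Y : set (GL K n)) (f g : GL K n -> K).

(** The determinant as a polynomial in the n * n entries, which gives common
    denominators to regular functions. *)
Definition detp : mpoly (n * n) K :=
  \det (\matrix_(i, j) mpolyX K (mnm1 (mxvec_index i j)) : 'M_n).

Lemma entriesE (x : 'M[K]_n) i j : entries x (mxvec_index i j) = x i j.
Proof. by rewrite /entries mxvecE. Qed.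

Lemma meval_detp (x : 'M[K]_n) : meval (entries x) detp = \det x.
Proof.
rewrite /detp -det_map_mx; congr (\det _); apply/matrixP=> i j.
by rewrite mxE /= mxE mevalXU entriesE.
Qed.

Lemma eq_regular X f g : (forall x, X x -> f x = g x) ->
  regular X f -> regular X g.
Proof. by move=> fg [p [e fp]]; exists p, e => x Xx; rewrite -fg ?fp. Qed.

Lemma regular_cst X c : regular X (fun=> c).
Proof. by exists (mpolyC _ c), 0%N => x _; rewrite mevalC expr0 divr1. Qed.

Lemma regular_entry X i j : regular X (fun x => x i j).
Proof.
exists (mpolyX K (mnm1 (mxvec_index i j))), 0%N => x _.
by rewrite mevalXU entriesE expr0 divr1.
Qed.

Lemma regular_invdet X : regular X (fun x => (\det x)^-1).
Proof. by exists 1, 1%N => x _; rewrite meval1 expr1 div1r. Qed.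

Lemma regularD X f g : regular X f -> regular X g ->
  regular X (fun x => f x + g x).
Proof.
move=> [p [d fp]] [q [e gq]]; exists (p * detp ^+ e + q * detp ^+ d), (d + e)%N.
move=> x Xx; rewrite fp // gq // mevalD !mevalM !rmorphXn /= meval_detp.
have dx := det_gl_neq0 x.
by rewrite addf_div ?expf_neq0 // exprD.
Qed.

Lemma regularM X f g : regular X f -> regular X g ->
  regular X (fun x => f x * g x).
Proof.
move=> [p [d fp]] [q [e gq]]; exists (p * q), (d + e)%N => x Xx.
by rewrite fp // gq // mevalM mulf_div exprD.
Qed.

Lemma regularX X f k : regular X f -> regular X (fun x => f x ^+ k).
Proof.
move=> rf; elim: k => [|k IH]; first exact: regular_cst.
by apply: eq_regular (regularM rf IH) => x _; rewrite exprS.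
Qed.

Lemma regular_sum X (I : Type) (s : seq I) (P : pred I) (F : I -> GL K n -> K) :
  (forall i, regular X (F i)) -> regular X (fun x => \sum_(i <- s | P i) F i x).
Proof.
move=> rF; elim: s => [|i s IH].
  by apply: eq_regular (regular_cst X 0) => x _; rewrite big_nil.
case Pi : (P i); last by apply: eq_regular IH => x _; rewrite big_cons Pi.
by apply: eq_regular (regularD (rF i) IH) => x _; rewrite big_cons Pi.
Qed.

Lemma regular_prod X (I : Type) (s : seq I) (P : pred I) (F : I -> GL K n -> K) :
  (forall i, regular X (F i)) -> regular X (fun x => \prod_(i <- s | P i) F i x).
Proof.
move=> rF; elim: s => [|i s IH].
  by apply: eq_regular (regular_cst X 1) => x _; rewrite big_nil.
case Pi : (P i); last by apply: eq_regular IH => x _; rewrite big_cons Pi.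
by apply: eq_regular (regularM (rF i) IH) => x _; rewrite big_cons Pi.
Qed.

Lemma regular_meval X m (v : GL K n -> 'I_m -> K) p :
  (forall i, regular X (fun x => v x i)) -> regular X (fun x => meval (v x) p).
Proof.
move=> rv; apply: (@eq_regular X (fun x => \sum_(m <- msupp p)
  (mcoeff m p * \prod_i v x i ^+ m i))); first by move=> x _; rewrite mevalE.
apply: regular_sum => k; apply: regularM; first exact: regular_cst.
by apply: regular_prod => i; apply: regularX.
Qed.

Lemma regular_det X m (M : GL K n -> 'M[K]_m) :
  (forall i j, regular X (fun x => M x i j)) -> regular X (fun x => \det (M x)).
Proof.
move=> rM; apply: regular_sum => s; apply: regularM; first exact: regular_cst.
exact: regular_prod.
Qed.

(** The denominator of a regular function, a power of the determinant, vanishes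
    nowhere. *)
Lemma regular_zeros X f : regular X f ->
  exists p : mpoly (n * n) K,
    forall x, X x -> f x = 0 <-> meval (entries x) p = 0.
Proof.
move=> [p [e fp]]; exists p => x Xx; rewrite fp //.
split=> [/eqP|->]; last by rewrite mul0r.
by rewrite mulf_eq0 invr_eq0 expf_eq0 (negPf (det_gl_neq0 x)) andbF orbF => /eqP.
Qed.

End RegularRing.

Section RegularMap.
Variable K : closedFieldType.

(** Regularity of the inverse determinant is part of the definition, since a
    function regular on the target may have a power of the determinant as its
    denominator; with it regular maps compose. *)
Definition regmap n m (X : set (GL K n)) (f : GL K n -> GL K m) :=
  (forall i j, regular X (fun x => f x i j)) /\
  regular X (fun x => (\det (f x))^-1).

Lemma regular_comp n m (X : set (GL K n)) (Y : set (GL K m)) f h :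
  regmap X f -> (forall x, X x -> Y (f x)) -> regular Y h ->
  regular X (fun x => h (f x)).
Proof.
move=> [rf rdf] XY [p [e hp]].
apply: (@eq_regular _ _ _
  (fun x => meval (entries (f x)) p * (\det (f x))^-1 ^+ e)).
  by move=> x /XY/hp ->; rewrite exprVn.
apply: regularM; last exact: regularX.
apply: regular_meval => k.
case/mxvec_indexP: k => i j; apply: eq_regular (rf i j) => x _.
by rewrite entriesE.
Qed.

Lemma regmap_comp n m l (X : set (GL K n)) (Y : set (GL K m))
    (f : GL K n -> GL K m) (g : GL K m -> GL K l) :
  regmap X f -> (forall x, X x -> Y (f x)) -> regmap Y g ->
  regmap X (fun x => g (f x)).
Proof.
move=> rf XY [rg rdg]; split=> [i j|].
  exact: (@regular_comp _ _ _ _ _ (fun y => g y i j) rf XY).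
exact: (@regular_comp _ _ _ _ _ (fun y => (\det (g y))^-1) rf XY).
Qed.

Lemma eq_regmap n m (X : set (GL K n)) (f g : GL K n -> GL K m) :
  (forall x, X x -> f x = g x) -> regmap X f -> regmap X g.
Proof.
move=> fg [rf rdf]; split=> [i j|].
  by apply: eq_regular (rf i j) => x Xx; rewrite fg.
by apply: eq_regular rdf => x Xx; rewrite fg.
Qed.

Lemma regmap_id n (X : set (GL K n)) : regmap X id.
Proof. by split=> [i j|]; [exact: regular_entry|exact: regular_invdet]. Qed.

Lemma regmap_cst n m (X : set (GL K n)) (c : GL K m) : regmap X (fun=> c).
Proof. by split=> [i j|]; exact: regular_cst. Qed.

Lemma regmapM n m (X : set (GL K n)) (f g : GL K n -> GL K m) :
  regmap X f -> regmap X g -> regmap X (fun x => f x * g x)%g.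
Proof.
move=> [rf rdf] [rg rdg]; split=> [i j|].
  apply: (@eq_regular _ _ _ (fun x => \sum_k f x i k * g x k j)).
    by move=> x _; rewrite glvalM mxE.
  by apply: regular_sum => k; apply: regularM.
apply: eq_regular (regularM rdf rdg) => x _.
by rewrite glvalM det_mulmx invfM.
Qed.

(** The inverse determinant of f is the determinant of the inverse of f, so it
    suffices that both f and its inverse have regular entries. *)
Lemma regmap_entries n m (X : set (GL K n)) (f : GL K n -> GL K m) :
  (forall i j, regular X (fun x => f x i j)) ->
  (forall i j, regular X (fun x => (f x)^-1%g i j)) -> regmap X f.
Proof.
move=> rf rfV; split=> //.
apply: eq_regular (regular_det rfV) => x _.
by rewrite glvalV det_inv.
Qed.

Lemma regmapV n m (X : set (GL K n)) (f : GL K n -> GL K m) :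
  regmap X f -> regmap X (fun x => (f x)^-1)%g.
Proof.
move=> [rf rdf]; apply: regmap_entries => i j; last first.
  by apply: eq_regular (rf i j) => x _; rewrite invgK.
apply: (@eq_regular _ _ _ (fun x => (\det (f x))^-1 * cofactor (f x) j i)).
  by move=> x _; rewrite glvalV /invmx glvalP !mxE.
apply: regularM => //; rewrite /cofactor.
apply: regularM; first exact: regular_cst.
apply: (@regular_det _ _ _ _ (fun x => row' j (col' i (f x)))) => k l.
by apply: eq_regular (rf (lift j k) (lift i l)) => x _; rewrite !mxE.
Qed.

(** A regular map is continuous for the Zariski topology induced on X. *)
Lemma regmap_closed n m (X : set (GL K n)) (f : GL K n -> GL K m) Z :
  regmap X f -> closed Z ->
  exists2 Z', closed Z' & forall x, X x -> Z (f x) <-> Z' x.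
Proof.
move=> rf /zariski_closedE[P ->].
have /choice[q qP] : forall p : mpoly (m * m) K, exists q : mpoly (n * n) K,
    forall x, X x -> meval (entries (f x)) p = 0 <-> meval (entries x) q = 0.
  move=> p; apply: regular_zeros.
  apply: (@regular_comp _ _ _ setT _ (fun y => meval (entries y) p) rf) => //.
  apply: regular_meval => k; case/mxvec_indexP: k => i j.
  by apply: eq_regular (regular_entry _ i j) => y _; rewrite entriesE.
exists (zeros [set q p | p in P]).
  by apply/zariski_closedE; exists [set q p | p in P].
move=> x Xx; split=> [Px _ [p Pp <-]|qx p Pp]; first exact/qP/Px.
by apply/(qP p x Xx)/qx; exists p.
Qed.

Lemma closed_regmap n m (X : set (GL K n)) (f : GL K n -> GL K m) Z :
  closed X -> regmap X f -> closed Z -> closed [set x | X x /\ Z (f x)].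
Proof.
move=> cX rf cZ; have [Z' cZ' ZZ'] := regmap_closed rf cZ.
have -> : [set x | X x /\ Z (f x)] = X `&` Z'.
  by apply/seteqP; split=> x [Xx] h; split=> //; apply/(ZZ' x Xx).
exact: closedI.
Qed.

Lemma closed_gl1 n (a : GL K n) : closed [set a].
Proof.
apply/zariski_closedE.
exists [set p | exists i j, p = mpolyX K (mnm1 (mxvec_index i j)) - mpolyC _ (a i j)].
apply/seteqP; split=> [_ -> p [i [j ->]]|x xa].
  by rewrite mevalB mevalXU mevalC entriesE subrr.
apply: val_inj; apply/matrixP => i j; apply/eqP; rewrite -subr_eq0; apply/eqP.
by rewrite -[RHS](xa _ (ex_intro _ i (ex_intro _ j erefl))) mevalB mevalXU mevalC entriesE.
Qed.

Lemma irreducible_image n m (X : set (GL K n)) (f : GL K n -> GL K m) :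
  irreducible_set X -> regmap X f -> irreducible_set (f @` X).
Proof.
move=> [[x0 Xx0] irrX] rf; split; first by exists (f x0), x0.
move=> A B cA cB XAB.
have [A' cA' AA'] := regmap_closed rf cA.
have [B' cB' BB'] := regmap_closed rf cB.
have [|XA'|XB'] := irrX _ _ cA' cB'.
- move=> x Xx; have [|/AA'|/BB'] := XAB (f x); first by exists x.
    by left; tauto.
  by right; tauto.
- by left=> _ [x Xx <-]; apply/AA' => //; apply: XA'.
- by right=> _ [x Xx <-]; apply/BB' => //; apply: XB'.
Qed.

(** If a nonempty relatively open and closed subset is X `&` C = X `&` D with C
    open and D closed, then X is covered by the closed sets D and ~` C. *)
Lemma irreducible_connected n (X : set (GL K n)) :
  irreducible_set X -> connected X.
Proof.
move=> [_ irrX] B [b Bb] [C oC BC] [D cD BD].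
have [|XD|XC] := irrX D (~` C) cD (open_closedC oC).
- move=> x Xx; have [Cx|] := pselect (C x); last by right.
  by left; have : B x by [rewrite BC]; rewrite BD => -[].
- by rewrite BD; apply/seteqP; split=> [x []|x Xx] //; split=> //; exact: XD.
- by move: Bb; rewrite BC => -[/XC].
Qed.

End RegularMap.

(** * Diagonal tori and their monomial homomorphisms *)

Section Torus.
Variable K : closedFieldType.

Lemma Gm_offdiag q (t : GL K q) i j : Gm K q t -> i != j -> t i j = 0.
Proof. by move=> /is_diag_mxP; apply. Qed.

Lemma Gm_neq0 q (t : GL K q) i : Gm K q t -> t i i != 0.
Proof.
move=> /diag_mxP[d td]; have := det_gl_neq0 t.
rewrite td det_diag mxE eqxx mulr1n; apply: contraNneq => d0.
by rewrite (bigD1 i) //= d0 mul0r.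
Qed.

Lemma Gm_eq q (s t : GL K q) :
  Gm K q s -> Gm K q t -> (forall i, s i i = t i i) -> s = t.
Proof.
move=> Gs Gt st; apply: val_inj; apply/matrixP=> i j.
by case: (eqVneq i j) => [->|ij]; [exact: st|rewrite /= !Gm_offdiag].
Qed.

Lemma Gm1 q : Gm K q 1%g.
Proof. by apply/is_diag_mxP => i j ij; rewrite glval1 mxE -val_eqE (negPf ij). Qed.

Lemma Gm_mulE q (s t : GL K q) i : Gm K q s -> (s * t)%g i i = s i i * t i i.
Proof.
move=> Gs; rewrite glvalM mxE (bigD1 i) //= big1 ?addr0 // => k ki.
by rewrite Gm_offdiag ?mul0r // eq_sym.
Qed.

Lemma GmM q (s t : GL K q) : Gm K q s -> Gm K q t -> Gm K q (s * t)%g.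
Proof.
move=> Gs Gt; apply/is_diag_mxP => i j ij.
rewrite glvalM mxE big1 // => k _; case: (eqVneq i k) => [ik|ik].
  by rewrite (Gm_offdiag Gt) ?mulr0 // -ik.
by rewrite Gm_offdiag ?mul0r.
Qed.

Lemma Gm_mulC q (s t : GL K q) : Gm K q s -> Gm K q t -> (s * t = t * s)%g.
Proof.
by move=> Gs Gt; apply: Gm_eq => [||i]; rewrite ?Gm_mulE 1?mulrC //; apply: GmM.
Qed.

(** The value is 1 when some v j is zero. *)
Definition tor q (v : 'I_q -> K) : GL K q := insubd (1%g : GL K q) (diag_mx (\row_j v j)).

Lemma tor_Gm q (v : 'I_q -> K) : Gm K q (tor v).
Proof.
rewrite /Gm /= /tor; have [u|u] := boolP (diag_mx (\row_j v j) \in unitmx).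
  by rewrite [glval _](insubdK _ u); apply: diag_mx_is_diag.
by rewrite /insubd insubN //; exact: Gm1.
Qed.

Lemma torE q (v : 'I_q -> K) i : (forall j, v j != 0) -> tor v i i = v i.
Proof.
move=> v0; rewrite /tor [glval _]insubdK ?mxE ?eqxx ?mulr1n ?mxE //.
rewrite unfold_in unitmxE det_diag unitfE; apply/prodf_neq0 => j _.
by rewrite mxE.
Qed.

Lemma GmV q (t : GL K q) : Gm K q t -> Gm K q t^-1%g.
Proof.
move=> Gt; suff -> : t^-1%g = tor (fun i => (t i i)^-1) by exact: tor_Gm.
apply: mulg1_eq; apply: Gm_eq => [||i]; [|exact: Gm1|].
  by apply: GmM => //; apply: tor_Gm.
rewrite Gm_mulE // torE => [|j]; last by rewrite invr_eq0 Gm_neq0.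
by rewrite divff ?Gm_neq0 // glval1 mxE eqxx.
Qed.

Lemma Gm_invE q (t : GL K q) i : Gm K q t -> t^-1%g i i = (t i i)^-1.
Proof.
move=> Gt; have ti := Gm_neq0 i Gt.
apply: (mulfI ti); rewrite divff // -Gm_mulE // mulgV glval1 mxE eqxx //.
Qed.

Lemma GmX q (t : GL K q) k : Gm K q t -> Gm K q (t ^+ k)%g.
Proof.
by move=> Gt; elim: k => [|k IH]; [exact: Gm1|rewrite expgS; exact: GmM].
Qed.

Lemma Gm_expE q (t : GL K q) k i : Gm K q t -> (t ^+ k)%g i i = t i i ^+ k.
Proof.
move=> Gt; elim: k => [|k IH]; first by rewrite expg0 glval1 mxE eqxx expr0.
by rewrite expgS Gm_mulE // IH exprS.
Qed.

Lemma exprz_prod (I : Type) (s : seq I) (P : pred I) (F : I -> K) (z : int) :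
  (\prod_(i <- s | P i) F i) ^ z = \prod_(i <- s | P i) F i ^ z.
Proof.
apply: (big_morph (fun x => x ^ z)); last exact: exp1rz.
by move=> x y; rewrite expfzMl.
Qed.

Lemma exprz_sum (I : Type) (s : seq I) (P : pred I) (F : I -> int) (x : K) :
  x != 0 -> x ^ (\sum_(i <- s | P i) F i) = \prod_(i <- s | P i) x ^ F i.
Proof.
move=> x0; apply: (big_morph (fun z => x ^ z)); last exact: expr0z.
by move=> y z; rewrite expfzDr.
Qed.

(** The homomorphism gamma of tori defined by the matrix C, with values in
    diagonal matrices so that it can be composed.  As exponents act on the right,
    a product C *m D gives gm D after gm C. *)
Definition gm k m (C : 'M[int]_(k, m)) (t : GL K k) : GL K m :=
  tor (fun j => gamma C t ord0 j).

Lemma gm_Gm k m (C : 'M[int]_(k, m)) t : Gm K m (gm C t).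
Proof. exact: tor_Gm. Qed.

Lemma gmE k m (C : 'M[int]_(k, m)) t j : Gm K k t ->
  gm C t j j = \prod_i t i i ^ C i j.
Proof.
move=> Gt; rewrite /gm torE => [|l]; rewrite mxE //.
by apply/prodf_neq0 => i _; rewrite expfz_neq0 // Gm_neq0.
Qed.

Lemma ker_gammaE k m (C : 'M[int]_(k, m)) t :
  ker_gamma K k m C t <-> Gm K k t /\ gm C t = 1%g.
Proof.
split=> -[Gt Ct]; split=> //.
  apply: Gm_eq => [||j]; [exact: gm_Gm|exact: Gm1|].
  rewrite glval1 mxE eqxx gmE //; have /rowP/(_ j) := Ct; rewrite !mxE //.
apply/rowP=> j; rewrite !mxE.
by rewrite -gmE // Ct glval1 mxE eqxx.
Qed.

Lemma gmM k m (C : 'M[int]_(k, m)) s t : Gm K k s -> Gm K k t ->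
  gm C (s * t)%g = (gm C s * gm C t)%g.
Proof.
move=> Gs Gt; apply: Gm_eq => [||j]; [exact: gm_Gm|exact/GmM/gm_Gm/gm_Gm|].
rewrite Gm_mulE ?gmE //; [|exact: GmM|exact: gm_Gm].
by rewrite -big_split; apply: eq_bigr => i _; rewrite Gm_mulE // expfzMl.
Qed.

Lemma gm1 k m (C : 'M[int]_(k, m)) : gm C 1%g = 1%g.
Proof.
apply: (mulgI (gm C 1%g)); rewrite -gmM ?mulg1 //; exact: Gm1.
Qed.

Lemma gmV k m (C : 'M[int]_(k, m)) t : Gm K k t -> gm C t^-1%g = (gm C t)^-1%g.
Proof.
move=> Gt; apply/esym/mulg1_eq; rewrite -gmM ?mulgV ?gm1 //; exact: GmV.
Qed.

Lemma gmX k m (C : 'M[int]_(k, m)) t l : Gm K k t ->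
  gm C (t ^+ l)%g = (gm C t ^+ l)%g.
Proof.
move=> Gt; elim: l => [|l IH]; first exact: gm1.
by rewrite !expgS gmM ?IH //; apply: GmX.
Qed.

Lemma gm_mulmx k m l (C : 'M[int]_(k, m)) (D : 'M[int]_(m, l)) t : Gm K k t ->
  gm (C *m D) t = gm D (gm C t).
Proof.
move=> Gt; apply: Gm_eq => [||j]; [exact: gm_Gm|exact: gm_Gm|].
rewrite !gmE //; last exact: gm_Gm.
under eq_bigr => i _ do rewrite mxE exprz_sum ?Gm_neq0 //.
rewrite exchange_big; apply: eq_bigr => i _ /=; rewrite gmE // exprz_prod.
by apply: eq_bigr => x _; rewrite exprz_exp.
Qed.

Lemma gmD k m (C D : 'M[int]_(k, m)) t : Gm K k t ->
  gm (C + D) t = (gm C t * gm D t)%g.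
Proof.
move=> Gt; apply: Gm_eq => [||j]; [exact: gm_Gm|exact/GmM/gm_Gm/gm_Gm|].
rewrite Gm_mulE ?gmE //; last exact: gm_Gm.
by rewrite -big_split; apply: eq_bigr => i _; rewrite mxE expfzDr ?Gm_neq0.
Qed.

Lemma gm0 k m t : Gm K k t -> gm (0 : 'M[int]_(k, m)) t = 1%g.
Proof.
move=> Gt; apply: Gm_eq => [||j]; [exact: gm_Gm|exact: Gm1|].
by rewrite gmE // glval1 mxE eqxx big1 // => i _; rewrite mxE expr0z.
Qed.

Lemma gmN k m (C : 'M[int]_(k, m)) t : Gm K k t -> gm (- C) t = (gm C t)^-1%g.
Proof. by move=> Gt; apply/esym/mulg1_eq; rewrite -gmD // addrN gm0. Qed.

(** Scalar matrices give power maps: this turns matrix identities into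
    statements on torsion. *)
Lemma gm_scalar k c t : Gm K k t -> gm (c%:R%:M : 'M[int]_k) t = (t ^+ c)%g.
Proof.
move=> Gt; apply: Gm_eq => [||j]; [exact: gm_Gm|exact: GmX|].
rewrite gmE // Gm_expE // (bigD1 j) //= big1 => [|i ij].
  by rewrite mxE eqxx mulr1n mulr1 natz.
by rewrite mxE (negPf ij) mulr0n expr0z.
Qed.

Lemma gm_id k t : Gm K k t -> gm (1%:M : 'M[int]_k) t = t.
Proof. exact: (@gm_scalar k 1). Qed.

Lemma Gm_root q c (u : GL K q) : (0 < c)%N -> Gm K q u ->
  exists2 t, Gm K q t & (t ^+ c)%g = u.
Proof.
move=> c0 Gu.
have /choice[v vP] : forall i, exists x, x ^+ c = u i i.
  move=> i; have /closed_rootP[x] : size ('X^c - (u i i)%:P) != 1%N.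
    by rewrite size_XnsubC // eqSS -lt0n.
  rewrite /root !hornerE ?hornerXn subr_eq0 => /eqP xc; by exists x.
have v0 i : v i != 0.
  by have := Gm_neq0 i Gu; rewrite -vP expf_eq0 c0.
exists (tor v); first exact: tor_Gm.
apply: Gm_eq => [||i] //; first exact/GmX/tor_Gm.
by rewrite Gm_expE ?torE //; apply: tor_Gm.
Qed.

(** The entries of an element of order dividing c are roots of X ^ c - 1. *)
Lemma Gm_torsion_finite q c : (0 < c)%N ->
  finite_set [set t : GL K q | Gm K q t /\ (t ^+ c = 1)%g].
Proof.
move=> c0; have p0 : ('X^c - 1 : {poly K}) != 0.
  by rewrite -size_poly_eq0 size_XnsubC.
have [s sP] := closed_field_poly_normal ('X^c - 1 : {poly K}).
pose F (v : {ffun 'I_q -> seq_sub s}) := tor (fun i => val (v i)).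
apply: (@sub_finite_set _ _ (F @` setT)); last exact/finite_image/finite_finset.
move=> t [Gt tc].
have ts i : t i i \in s.
  rewrite -root_prod_XsubC; have := rootZ (t i i) (\prod_(z <- s) ('X - z%:P)).
  move=> /(_ (lead_coef ('X^c - 1))) <-; last by rewrite lead_coef_eq0.
  rewrite -sP /root !hornerE ?hornerXn -Gm_expE // tc glval1 mxE eqxx subrr.
  exact: eqxx.
exists [ffun i => SeqSub (ts i)] => //; apply: Gm_eq => //; first exact: tor_Gm.
by move=> i; rewrite /F torE => [|j]; rewrite ffunE //=; exact: Gm_neq0.
Qed.

Lemma enumerates_nu q k : (0 < k)%N ->
  exists e : 'I_(nu K k q) -> GL K q,
    enumerates e [set t | Gm K q t /\ order_elt t = k].
Proof.
move=> k0; apply: finite_enumerates.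
apply: sub_finite_set (Gm_torsion_finite q k0) => t [Gt tk]; split=> //.
exact: order_elt_eq0.
Qed.

Lemma closed_Gm q : closed (Gm K q).
Proof.
apply/zariski_closedE.
exists [set p | exists2 ij, ij.1 != ij.2 & p = mpolyX K (mnm1 (mxvec_index ij.1 ij.2))].
apply/seteqP; split=> [t Gt _ [[i j] ij ->]|t tP].
  by rewrite mevalXU entriesE Gm_offdiag.
apply/is_diag_mxP => i j ij; rewrite -entriesE.
have := tP _ (ex_intro2 _ _ (i, j) ij erefl).
by rewrite mevalXU.
Qed.

Lemma regular_expz q (z : int) i : regular (Gm K q) (fun t => t i i ^ z).
Proof.
case: z => k; first exact/regularX/regular_entry.
have [rV _] := regmapV (regmap_id (Gm K q)).
apply: (@eq_regular _ _ _ (fun t => (t^-1)%g i i ^+ k.+1)); last exact/regularX/rV.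
by move=> t Gt; rewrite Gm_invE // exprVn.
Qed.

Lemma regmap_tor n (X : set (GL K n)) q (v : GL K n -> 'I_q -> K) :
  (forall x i, X x -> v x i != 0) ->
  (forall i, regular X (v ^~ i)) ->
  (forall i, regular X (fun x => (v x i)^-1)) -> regmap X (fun x => tor (v x)).
Proof.
move=> v0 rv rvV; apply: regmap_entries => i j; case: (eqVneq i j) => [<-|ij].
- by apply: eq_regular (rv i) => x Xx; rewrite torE // => ?; apply: v0.
- apply: eq_regular (regular_cst X 0) => x Xx.
  by rewrite Gm_offdiag //; exact: tor_Gm.
- apply: eq_regular (rvV i) => x Xx.
  by rewrite Gm_invE ?torE //; [move=> ?; exact: v0|exact: tor_Gm].
- apply: eq_regular (regular_cst X 0) => x Xx.
  by rewrite Gm_offdiag //; exact/GmV/tor_Gm.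
Qed.

Lemma regmap_gm k m (C : 'M[int]_(k, m)) : regmap (Gm K k) (gm C).
Proof.
have rC (D : 'M[int]_(k, m)) j :
    regular (Gm K k) (fun t => \prod_i t i i ^ D i j).
  by apply: regular_prod => i; exact: regular_expz.
apply: regmap_tor => [t j Gt|j|j].
- by rewrite mxE; apply/prodf_neq0 => i _; rewrite expfz_neq0 // Gm_neq0.
- by apply: eq_regular (rC C j) => t Gt; rewrite mxE.
apply: eq_regular (rC (- C) j) => t Gt; rewrite mxE -prodfV.
by apply: eq_bigr => i _; rewrite mxE invr_expz.
Qed.

(** Two nonempty open subsets of the torus meet: on the line through a point of
    each, the parameters whose point leaves the torus or one of the open sets
    are roots of a nonzero polynomial, and K is infinite. *)
Lemma irreducible_Gm q : irreducible_set (Gm K q).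
Proof.
split; first by exists 1%g; exact: Gm1.
move=> _ _ /zariski_closedE[P ->] /zariski_closedE[Q ->] cover.
apply: contrapT => /not_orP[].
move=> /existsNP[a /not_implyP[Ga /existsNP[p /not_implyP[Pp /eqP pa]]]].
move=> /existsNP[b /not_implyP[Gb /existsNP[f /not_implyP[Qf /eqP fb]]]].
(* The line from a, at parameter 0, to b, at parameter 1. *)
pose L i : {poly K} := (a i i)%:P + 'X * (b i i - a i i)%:P.
pose M := mxvec (diag_mx (\row_i L i)) ord0.
pose ev (g : mpoly (q * q) K) : {poly K} :=
  \sum_(m <- msupp g) (mcoeff m g)%:P * \prod_k M k ^+ m k.
have evE g s : (ev g).[s] = meval (fun k => (M k).[s]) g.
  rewrite mevalE /ev horner_sum; apply: eq_bigr => m _.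
  rewrite hornerM hornerC horner_prod; congr (_ * _).
  by apply: eq_bigr => k _; rewrite horner_exp.
have ME x s : Gm K q x -> (forall i, x i i = (L i).[s]) ->
    forall g, meval (entries x) g = (ev g).[s].
  move=> Gx xL g; rewrite evE; apply: meval_eq => k; rewrite /M.
  case/mxvec_indexP: k => i j; rewrite entriesE mxvecE mxE.
  case: (eqVneq i j) => [<-|ij]; first by rewrite mulr1n mxE xL.
  by rewrite Gm_offdiag // mulr0n horner0.
have La i : a i i = (L i).[0] by rewrite /L !hornerE.
have Lb i : b i i = (L i).[1].
  by rewrite /L hornerD hornerC hornerM hornerX hornerC mul1r addrC subrK.
have ev0 g s : (ev g).[s] != 0 -> ev g != 0.
  by apply: contraNneq => ->; rewrite horner0.
have : ev p * ev f * \prod_i L i != 0.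
  rewrite !mulf_neq0 //.
  - by apply: (ev0 p 0); rewrite -(ME a).
  - by apply: (ev0 f 1); rewrite -(ME b).
  apply/prodf_neq0 => i _; have := Gm_neq0 i Ga; rewrite La.
  by apply: contraNneq => ->; rewrite horner0.
move=> /closed_nonrootP[s]; rewrite /root !hornerM horner_prod !mulf_eq0.
rewrite !negb_or => /andP[/andP[ps fs] /prodf_neq0 Ls].
have xL i : tor (fun i => (L i).[s]) i i = (L i).[s].
  by rewrite torE // => j; exact: Ls.
have Gx := @tor_Gm _ (fun i => (L i).[s]).
have [/(_ _ Pp)|/(_ _ Qf)] := cover _ Gx.
  by rewrite (ME _ _ Gx xL) => /eqP; apply/negP.
by rewrite (ME _ _ Gx xL) => /eqP; apply/negP.
Qed.

Lemma expz_eq1 (z : int) : (forall x : K, x != 0 -> x ^ z = 1) -> z = 0.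
Proof.
move=> z1; apply/eqP; apply: contraT => z0.
have k0 : (0 < `|z|)%N by rewrite absz_gt0.
have : ('X^`|z| - 1) * 'X != 0 :> {poly K}.
  rewrite mulf_neq0 ?polyX_eq0 // -size_poly_eq0 size_XnsubC //.
move=> /closed_nonrootP[x]; rewrite /root !hornerE ?hornerXn mulf_eq0 negb_or.
move=> /andP[+ x0]; rewrite subr_eq0 => /eqP[].
have := z1 x x0; case: (z) => m //= /(canRL (@invrK _)); rewrite invr1 => <-.
by [].
Qed.

(** It suffices to test on elements with a single entry x different from 1: since
    K is infinite, no nonzero power map is trivial on all x. *)
Lemma Gm_exponent_inj q (a b : 'I_q -> int) :
  (forall t, Gm K q t -> \prod_i t i i ^ a i = \prod_i t i i ^ b i) -> a =1 b.
Proof.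
move=> ab i; apply/eqP; rewrite -subr_eq0; apply/eqP/expz_eq1 => x x0.
have v0 j : (if j == i then x else 1) != 0 by case: ifP; rewrite ?oner_eq0.
have := ab (tor (fun j => if j == i then x else 1)) (@tor_Gm _ _).
have coll (c : 'I_q -> int) :
    \prod_j tor (fun j => if j == i then x else 1) j j ^ c j = x ^ c i.
  rewrite (bigD1 i) //= torE // eqxx big1 ?mulr1 // => j ji.
  by rewrite torE // (negPf ji) exp1rz.
by rewrite !coll expfzDr // => ->; rewrite -expfzDr // subrr expr0z.
Qed.

Lemma gm_inj k m (C D : 'M[int]_(k, m)) :
  (forall t : GL K k, Gm K k t -> gm C t = gm D t) -> C = D.
Proof.
move=> CD; apply/matrixP=> i j.
apply: (@Gm_exponent_inj k (C ^~ j) (D ^~ j)) => t Gt.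
by rewrite -!gmE // CD.
Qed.

End Torus.

(** * Integer matrices *)

(** In the Smith normal form C = L D R, take for A the rows of R whose invariant
    factor is nonzero and for A' the matching columns of R^-1.  The first identity
    says that the row lattice of A is a direct factor, the second that it contains
    the rows of C, and the third that C *m A' has a left inverse up to the nonzero
    integer c. *)
Lemma int_image_factor k m (C : 'M[int]_(k, m)) :
  exists rho (A : 'M[int]_(rho, m)) (A' : 'M[int]_(m, rho))
      (S : 'M[int]_(rho, k)) c,
    [/\ (0 < c)%N, A *m A' = 1%:M, C *m A' *m A = C & S *m C *m A' = c%:R%:M].
Proof.
have [L Lu [R Ru [d _ CE]]] := int_Smith_normal_form C.
set D := (\matrix_(i, j) _) in CE.
pose P : pred 'I_(minn k m) := fun i => d`_i != 0.
pose u (a : 'I_#|P|) : 'I_k := widen_ord (geq_minl k m) (enum_val a).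
pose v (a : 'I_#|P|) : 'I_m := widen_ord (geq_minr k m) (enum_val a).
pose e (a : 'I_#|P|) := d`_(enum_val a).
have e0 a : e a != 0 by exact: (enum_valP a).
have vinj : injective v.
  by move=> a b /(congr1 val)/= ab; apply/enum_val_inj/val_inj.
(* A common multiple of the invariant factors; g a is the quotient of c by e a. *)
pose c := (\prod_a `|e a|)%N.
pose g a : int := Num.sg (e a) * (\prod_(b | b != a) `|e b|)%:Z.
have gE a : g a * e a = c%:R.
  by rewrite natz /g /c [in RHS](bigD1 a) //= PoszM abszE mulrAC -Num.Theory.normrEsg.
exists #|P|, (rowsub v R), (colsub v (invmx R)),
  (diag_mx (\row_a g a) *m rowsub u (invmx L)), c; split.
- by rewrite prodn_gt0 // => a; rewrite absz_gt0.
- rewrite mul_rowsub_mx mulmx_colsub mulmxV //; apply/matrixP=> a b.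
  by rewrite !mxE (inj_eq vinj).
- rewrite mulmx_colsub {1}CE -mulmxA mulmxV // mulmx1 [RHS]CE.
  apply/matrixP=> i j; rewrite !mxE.
  rewrite [RHS](bigID (mem (v @: [set: 'I_#|P|])%SET)) /= [X in _ + X]big1 ?addr0.
    rewrite big_imset /=; last by move=> ? ? _ _; apply: vinj.
    by apply: eq_big => [a|a _]; rewrite ?inE // !mxE.
  move=> l lv; rewrite mxE big1 ?mul0r // => x _; rewrite mxE.
  case: eqP => [xl|]; last by rewrite mulr0n mulr0.
  (* Columns outside the selection vanish in D. *)
  have lkm : (l < minn k m)%N by rewrite ltn_min -{1}xl !ltn_ord.
  have [->|dx] := eqVneq d`_x 0; first by rewrite mul0rn mulr0.
  have Pl : Ordinal lkm \in P by rewrite unfold_in /P /= -xl.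
  case/negP: lv; apply/imsetP; exists (enum_rank_in Pl (Ordinal lkm)); first by rewrite inE.
  by apply: val_inj; rewrite /= enum_rankK_in.
- rewrite -!mulmxA mulmx_colsub {1}CE -mulmxA mulmxV // mulmx1.
  rewrite mul_rowsub_mx mulmx_colsub mulmxA mulVmx // mul1mx.
  apply/matrixP=> a b; rewrite mul_diag_mx !mxE /=.
  case: (eqVneq a b) => [->|ab]; first by rewrite eqxx mulr1n gE.
  case: eqP => [/val_inj/enum_val_inj/eqP|_]; first by rewrite (negPf ab).
  by rewrite mulr0n mulr0.
Qed.

Local Notation toQ := (map_mx (intr : int -> rat)).

Lemma rank_scalarQ r d : (0 < d)%N -> \rank (toQ (d%:R%:M : 'M[int]_r)) = r.
Proof.
move=> d0; rewrite map_scalar_mx mxrank_unit //.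
by rewrite unitmxE det_scalar unitfE expf_neq0 // rmorph_nat Num.Theory.pnatr_eq0 -lt0n.
Qed.

(** The two identities bound the rank of C from above and from below. *)
Lemma image_factor_rank k m rho (C : 'M[int]_(k, m)) (A : 'M[int]_(rho, m))
    (A' : 'M[int]_(m, rho)) (S : 'M[int]_(rho, k)) c :
  (0 < c)%N -> C *m A' *m A = C -> S *m C *m A' = c%:R%:M ->
  \rank (toQ C) = rho.
Proof.
move=> c0 CA SC; apply/eqP; rewrite eqn_leq; apply/andP; split.
  by rewrite -CA map_mxM (leq_trans (mxrankM_maxr _ _)) // rank_leq_row.
rewrite -[leqLHS](rank_scalarQ rho c0) -SC !map_mxM.
by rewrite (leq_trans (mxrankM_maxl _ _)) // mxrankM_maxr.
Qed.

Section PeriodicMatrix.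
Variables (r d : nat) (P : 'M[int]_r).
Hypotheses (d0 : (0 < d)%N) (Pd : P ^+ d = 1).
Local Notation B := (\sum_(i < d) P ^+ i).
Local Notation Q := (1 - P).

Lemma norm_subr1 : Q * B = 0.
Proof. by rewrite -opprB mulNr -subrX1 Pd subrr oppr0. Qed.

Lemma norm_comm : B * Q = Q * B.
Proof.
apply/esym/commr_sum => i _; apply/commrX.
by apply/commr_sym; apply: commrB; [exact: commr1|].
Qed.

(** Each 1 - P ^+ i is a multiple of 1 - P. *)
Lemma norm_complement : exists U : 'M[int]_r, B + Q * U = d%:R%:M /\ Q * U = U * Q.
Proof.
exists (\sum_(i < d) \sum_(j < i) P ^+ j); split.
  rewrite mulr_sumr -big_split /=.
  under eq_bigr => i _.
    rewrite -[1 - P]opprB mulNr -subrX1 opprB addrC subrK; over.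
  by rewrite sumr_const card_ord raddfMn.
apply: commr_sum => i _; apply: commr_sum => j _; apply: commrX.
by apply/commr_sym; apply: commrB; [exact: commr1|].
Qed.

Lemma rank_eigenspace1 :
  \rank (eigenspace (toQ P)^T 1) = (r - \rank (toQ (1%:M - P)))%N.
Proof.
rewrite /eigenspace mxrank_ker; congr (_ - _)%N.
rewrite map_mxB map_mx1 -mxrank_tr -[in RHS]mxrank_opp opprB linearB /=.
by rewrite trmxK tr_scalar_mx.
Qed.

(** Since B (1 - P) = 0, the ranks of B and of 1 - P add up to at most r; since d
    is the sum of B and of a multiple of 1 - P, they add up to at least r. *)
Lemma rank_norm : \rank (toQ B) = \rank (eigenspace (toQ P)^T 1).
Proof.
rewrite rank_eigenspace1; have [U [BU _]] := norm_complement.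
have h1 : (\rank (toQ B) + \rank (toQ (1%:M - P)) <= r)%N.
  by rewrite mulmx0_rank_max // -map_mxM -[_ *m _]/(B * Q) norm_comm norm_subr1 map_mx0.
have h2 : (r <= \rank (toQ B) + \rank (toQ (1%:M - P)))%N.
  rewrite -[leqLHS](rank_scalarQ r d0) -BU.
  rewrite map_mxD (leq_trans (mxrank_add _ _)) // leq_add2l.
  by rewrite -[Q * U]/(Q *m U) map_mxM mxrankM_maxl.
apply/eqP; rewrite -(eqn_add2r (\rank (toQ (1%:M - P)))) subnK ?eqn_leq ?h1 //.
by rewrite (leq_trans _ h1) ?leq_addl.
Qed.

End PeriodicMatrix.

(** * Characters and coordinates on a torus *)

(** A form of the linear independence of characters, where the psi i may vanish.
    If h x0 differs from psi a x0, then comparing h (x0 * x) with psi a x0 * h x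
    expresses a nonzero multiple of h by the remaining psi i. *)
Lemma mult_in_span (K : closedFieldType) n (X : set (GL K n)) (I : Type)
    (s : seq I) (c : I -> K) (psi : I -> GL K n -> K) (h : GL K n -> K) :
  X 1%g -> (forall x y, X x -> X y -> X (x * y)%g) ->
  (forall i x y, X x -> X y -> psi i (x * y)%g = psi i x * psi i y) ->
  h 1%g != 0 -> (forall x y, X x -> X y -> h (x * y)%g = h x * h y) ->
  (forall x, X x -> h x = \sum_(i <- s) c i * psi i x) ->
  exists i, forall x, X x -> h x = psi i x.
Proof.
move=> X1 XM psiM h1 hM; elim: s c => [|a s IH] c hs.
  by move: h1; rewrite hs // big_nil eqxx.
have [ha|/existsNP[x0 /not_implyP[Xx0 /eqP hx0]]] :=
  pselect (forall x, X x -> h x = psi a x); first by exists a.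
have d0 : h x0 - psi a x0 != 0 by rewrite subr_eq0.
set del := h x0 - psi a x0 in d0.
apply: (IH (fun i => del^-1 * (c i * (psi i x0 - psi a x0)))) => x Xx.
apply: (mulfI d0); transitivity (h (x0 * x)%g - psi a x0 * h x).
  by rewrite hM // mulrBl.
rewrite (hs (x0 * x)%g) ?(hs x) //; last exact: XM.
rewrite !big_cons mulrDr !mulr_sumr psiM //.
rewrite opprD addrACA mulrCA subrr add0r -sumrB; apply: eq_bigr => i _.
rewrite !mulrA mulfV // mul1r psiM //.
by rewrite mulrBr mulrBl !mulrA (mulrC (psi a x0)).
Qed.

Section GmCharacters.
Variable K : closedFieldType.

Lemma Gm_det q (t : GL K q) : Gm K q t -> \det t = \prod_i t i i.
Proof.
move=> /diag_mxP[D ->]; rewrite det_diag.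
by apply: eq_bigr => i _; rewrite mxE eqxx mulr1n.
Qed.

(** On diagonal matrices every monomial in the entries, divided by a power of the
    determinant, is multiplicative.  So a character, being a combination of such
    functions, is one of them. *)
Lemma Gm_character_monomial q (h : GL K q -> K) : character (Gm K q) h ->
  exists a : 'I_q -> int, forall t, Gm K q t -> h t = \prod_i t i i ^ a i.
Proof.
move=> [[p [e hp]] h0 hM].
pose psi (m : multinom (q * q)) (t : GL K q) :=
  (\prod_k entries t k ^+ m k) / \det t ^+ e.
have psiM (m : multinom (q * q)) x y :
    Gm K q x -> Gm K q y -> psi m (x * y)%g = psi m x * psi m y.
  move=> Gx Gy; rewrite /psi glvalM det_mulmx mulf_div -exprMn -big_split /=.
  congr (_ / _); apply: eq_bigr => k _; rewrite -exprMn; congr (_ ^+ _).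
  case/mxvec_indexP: k => i j; rewrite !entriesE.
  case: (eqVneq i j) => [<-|ij]; first by rewrite -glvalM Gm_mulE.
  by rewrite -glvalM !Gm_offdiag ?mul0r //; apply: GmM.
have h1 : h 1%g != 0 by apply: h0; exact: Gm1.
have [||m hm] := @mult_in_span K q (Gm K q) _ (msupp p) (fun m => mcoeff m p) psi h
   (@Gm1 K q) _ psiM h1 hM.
- by move=> x y; apply: GmM.
- move=> x Gx; rewrite hp // mevalE mulr_suml; apply: eq_bigr => m _.
  by rewrite /psi mulrA.
have m0 i j : i != j -> m (mxvec_index i j) = 0%N.
  move=> ij; move: h1; rewrite hm; last exact: Gm1.
  rewrite /psi mulf_eq0 negb_or => /andP[/prodf_neq0/(_ (mxvec_index i j) isT)].
  rewrite entriesE Gm_offdiag //; last exact: Gm1.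
  by rewrite expf_eq0 eqxx andbT -eqn0Ngt => /eqP.
(* The determinant of t is the product of its diagonal entries. *)
exists (fun i => (m (mxvec_index i i))%:Z - e%:Z) => t Gt; rewrite hm //.
under [RHS]eq_bigr => i _ do rewrite expfzDr ?Gm_neq0 //.
rewrite big_split /=; congr (_ * _).
  rewrite (reindex _ (curry_mxvec_bij q q)) /=.
  rewrite (eq_bigr (fun ij => t ij.1 ij.2 ^+ m (mxvec_index ij.1 ij.2))).
    rewrite -(pair_bigA _ (fun i j => t i j ^+ m (mxvec_index i j))) /=.
    apply: eq_bigr => i _; rewrite (bigD1 i) //= big1 ?mulr1 // => j ji.
    by rewrite m0 ?expr0 // eq_sym.
  by move=> [i j] _ /=; rewrite entriesE.
by rewrite Gm_det // -prodrXl -prodfV; apply: eq_bigr => i _; rewrite exprnN.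
Qed.

End GmCharacters.

Section Chart.
Variables (K : closedFieldType) (n : nat) (T : set (GL K n)).

(** Inverse isomorphisms, of varieties and of groups, between T and the diagonal
    torus: th gives the coordinates of an element of T, io the element with given
    coordinates. *)
Record chart r (th : GL K n -> GL K r) (io : GL K r -> GL K n) : Prop := Chart {
  chart_closed : closed T;
  chart_Gm : forall t, T t -> Gm K r (th t);
  chart_mem : forall u, Gm K r u -> T (io u);
  chartK : forall t, T t -> io (th t) = t;
  chartVK : forall u, Gm K r u -> th (io u) = u;
  chartM : forall u v, Gm K r u -> Gm K r v -> io (u * v)%g = (io u * io v)%g;
  chart_regmap : regmap T th;
  chartV_regmap : regmap (Gm K r) io }.

Lemma subgroupP (H : set (GL K n)) : subgroup H ->
  [/\ H 1%g, forall x y, H x -> H y -> H (x * y)%g & forall x, H x -> H x^-1%g].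
Proof.
move=> gH; have [/set_mem H1 HF] := gH.
have HV x : H x -> H x^-1%g.
  by move=> Hx; rewrite -[x^-1%g]mul1g; apply/set_mem/HF; rewrite inE.
split=> // x y Hx Hy; rewrite -[y]invgK; apply/set_mem/HF; rewrite ?inE //.
exact: HV.
Qed.

(** The inverse of a point is a regular function of it, so the morphism conditions
    on f and g, applied to inverses, make their inverse determinants regular. *)
Lemma chart_exists r : torus_of_dim r T -> exists th io, @chart r th io.
Proof.
move=> [[cT /subgroupP[T1 TM TV]] [f [[[fG fr] [g [[gT gr] fK gK]]] fM]]].
have gM u v : Gm K r u -> Gm K r v -> g (u * v)%g = (g u * g v)%g.
  move=> Gu Gv; rewrite -[u in LHS]gK // -[v in LHS]gK // -fM ?fK //.
  - exact/TM/gT/Gv/gT.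
  - exact: gT.
  - exact: gT.
have f1 : f 1%g = 1%g by apply: (mulgI (f 1%g)); rewrite -fM ?mulg1.
have g1 : g 1%g = 1%g.
  by apply: (mulgI (g 1%g)); rewrite -gM ?mulg1 //; exact: Gm1.
exists f, g; split=> //.
- apply: regmap_entries => // i j.
  apply: (@eq_regular _ _ _ (fun t => f t^-1%g i j)).
    move=> t Tt; congr (glval _ _ _); apply/esym/mulg1_eq.
    by rewrite -fM ?mulgV //; exact: TV.
  exact: (regular_comp (h := fun t => f t i j) (regmapV (regmap_id T)) TV).
- apply: regmap_entries => // i j.
  apply: (@eq_regular _ _ _ (fun t => g t^-1%g i j)).
    move=> t Gt; congr (glval _ _ _); apply/esym/mulg1_eq.
    by rewrite -gM ?mulgV //; exact: GmV.
  exact: (regular_comp (h := fun t => g t i j) (regmapV (regmap_id _)) (@GmV _ _)).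
Qed.

Section ChartTheory.
Variables (r : nat) (th : GL K n -> GL K r) (io : GL K r -> GL K n).
Hypothesis ch : chart th io.

Lemma chart_thM s t : T s -> T t -> th (s * t)%g = (th s * th t)%g.
Proof.
move=> Ts Tt; rewrite -{1}(chartK ch Ts) -{1}(chartK ch Tt) -(chartM ch) ?(chartVK ch) //.
- by apply: GmM; apply: (chart_Gm ch).
- exact: (chart_Gm ch).
- exact: (chart_Gm ch).
Qed.

Lemma chart_mulT s t : T s -> T t -> T (s * t)%g.
Proof.
move=> Ts Tt; rewrite -(chartK ch Ts) -(chartK ch Tt) -(chartM ch); try exact: (chart_Gm ch).
by apply: (chart_mem ch); apply: GmM; apply: (chart_Gm ch).
Qed.

Lemma chart_io1 : io 1%g = 1%g.
Proof. by apply: (mulgI (io 1%g)); rewrite -(chartM ch) ?mulg1 //; exact: Gm1. Qed.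

Lemma chart_ioV u : Gm K r u -> io u^-1%g = (io u)^-1%g.
Proof.
move=> Gu; apply/esym/mulg1_eq.
by rewrite -(chartM ch) ?mulgV ?chart_io1 //; exact: GmV.
Qed.

Lemma chart_ioX u k : Gm K r u -> io (u ^+ k)%g = (io u ^+ k)%g.
Proof.
move=> Gu; elim: k => [|k IH]; first exact: chart_io1.
by rewrite !expgS (chartM ch) ?IH //; exact: GmX.
Qed.

Lemma chart_T1 : T 1%g.
Proof. by rewrite -chart_io1; apply: (chart_mem ch); exact: Gm1. Qed.

Lemma chart_mulTC s t : T s -> T t -> (s * t)%g = (t * s)%g.
Proof.
move=> Ts Tt; rewrite -(chartK ch Ts) -(chartK ch Tt) -!(chartM ch); try exact: (chart_Gm ch).
by rewrite Gm_mulC //; exact: (chart_Gm ch).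
Qed.

Lemma chart_TV t : T t -> T t^-1%g.
Proof.
move=> Tt; rewrite -(chartK ch Tt) -chart_ioV; last exact: (chart_Gm ch).
by apply: (chart_mem ch); apply: GmV; exact: (chart_Gm ch).
Qed.

Lemma chart_io_inj u v : Gm K r u -> Gm K r v -> io u = io v -> u = v.
Proof. by move=> Gu Gv uv; rewrite -(chartVK ch Gu) uv (chartVK ch). Qed.

Lemma chart_character psi : character T psi ->
  exists a : 'I_r -> int, forall t, T t -> psi t = \prod_i th t i i ^ a i.
Proof.
move=> [rpsi psi0 psiM].
have [|a aP] := @Gm_character_monomial K r (psi \o io).
  split=> [|u Gu|u v Gu Gv] /=.
  - exact: (regular_comp (chartV_regmap ch) (chart_mem ch) rpsi).
  - exact/psi0/(chart_mem ch).
  - by rewrite (chartM ch) // psiM //; exact: (chart_mem ch).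
exists a => t Tt; rewrite -aP; last exact: (chart_Gm ch).
by rewrite /= (chartK ch).
Qed.

Lemma chart_coord_character i : character T (fun t => th t i i).
Proof.
split=> [|t Tt|s t Ts Tt]; first by case: (chart_regmap ch) => /(_ i i).
- by apply: Gm_neq0; exact: (chart_Gm ch).
- by rewrite chart_thM // Gm_mulE //; exact: (chart_Gm ch).
Qed.

Lemma chart_char_basis : char_basis T (fun i t => th t i i).
Proof.
split=> [i|psi cpsi]; first exact: chart_coord_character.
have [a aP] := chart_character cpsi.
exists (\col_i a i); split=> [t Tt|b bP].
  by rewrite aP //; apply: eq_bigr => i _; rewrite mxE.
apply/colP=> i; rewrite mxE; apply: (@Gm_exponent_inj K r a (fun i => b i ord0)) => u Gu.
by rewrite -(chartVK ch Gu) -aP ?bP //; exact: (chart_mem ch).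
Qed.

(** Each coordinate of th is a monomial in the basis chi and conversely; by
    uniqueness of exponents the two exponent matrices A and B satisfy
    A *m B = 1. *)
Lemma chart_of_basis chi : char_basis T chi ->
  exists th' io', @chart r th' io' /\ forall t i, T t -> th' t i i = chi i t.
Proof.
move=> [cchi chiP].
have /choice[a aP] : forall i, exists a : 'cV[int]_r,
    forall t, T t -> th t i i = \prod_j chi j t ^ a j ord0.
  by move=> i; have [a [aP _]] := chiP _ (chart_coord_character i); exists a.
have /choice[b bP] : forall i, exists b : 'I_r -> int,
    forall t, T t -> chi i t = \prod_j th t j j ^ b j.
  by move=> i; exact: chart_character.
pose A := \matrix_(i, j) a j i ord0; pose B := \matrix_(i, j) b j i.
pose th' t := tor (chi ^~ t).
have th'E t i : T t -> th' t i i = chi i t.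
  by move=> Tt; rewrite torE // => j; case: (cchi j) => _ /(_ t Tt).
have Gth' t : Gm K r (th' t) by exact: tor_Gm.
have thE t : T t -> th t = gm A (th' t).
  move=> Tt; apply: Gm_eq => [||i]; [exact: (chart_Gm ch)|exact: gm_Gm|].
  by rewrite gmE // aP //; apply: eq_bigr => j _; rewrite mxE th'E.
have th'thE t : T t -> th' t = gm B (th t).
  move=> Tt; have Gt := chart_Gm ch Tt.
  apply: Gm_eq => // [|i]; first exact: gm_Gm.
  by rewrite gmE // th'E // bP //; apply: eq_bigr => j _; rewrite mxE.
have AB : A *m B = 1%:M.
  apply/matrixP=> i j; have [c [cP cuniq]] := chiP _ (cchi j).
  have : c = \col_l (A *m B) l j.
    apply: cuniq => t Tt; rewrite -th'E // th'thE // thE // -gm_mulmx // gmE //.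
    by apply: eq_bigr => l _; rewrite th'E // [in RHS]mxE.
  rewrite (cuniq (\col_l 1%:M l j)) => [/colP/(_ i)|t Tt].
    by rewrite mxE [in RHS]mxE => ->.
  rewrite -th'E // -[th' t in LHS]gm_id // gmE //.
  by apply: eq_bigr => l _; rewrite th'E // [in RHS]mxE.
exists th', (io \o gm A); split=> //; split=> //.
- exact: chart_closed ch.
- by move=> u Gu; apply: (chart_mem ch); exact: gm_Gm.
- by move=> t Tt /=; rewrite -thE // (chartK ch).
- move=> u Gu /=; rewrite th'thE; last by apply: (chart_mem ch); exact: gm_Gm.
  by rewrite (chartVK ch (gm_Gm A u)) -gm_mulmx // AB gm_id.
- by move=> u v Gu Gv /=; rewrite gmM // (chartM ch) //; exact: gm_Gm.
- apply: (@eq_regmap _ _ _ _ (gm B \o th)).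
    by move=> t Tt; rewrite th'thE.
  exact: (regmap_comp (chart_regmap ch) (chart_Gm ch) (regmap_gm K B)).
- apply: (regmap_comp (regmap_gm K A) _ (chartV_regmap ch)).
  by move=> u _; exact: gm_Gm.
Qed.

(** This makes Phi meaningful: it is not the default value of the choice in its
    definition. *)
Lemma pullback_matrix_exists w :
  (forall t, T t -> T (phi w t)) -> exists P : 'M[int]_r, pullback_matrix T w P.
Proof.
move=> wT.
have cphi j : character T (fun t => th (phi w t) j j).
  have [_ th0 thM] := chart_coord_character j.
  split=> [|t Tt|s t Ts Tt]; [|exact/th0/wT|]; last first.
    rewrite -thM; [|exact: wT|exact: wT].
    by rewrite /phi !mulgA mulgVK.
  have rphi : regmap T (phi w).
    apply: regmapM; last exact: regmap_cst.
    by apply: regmapM; [exact: regmap_cst|exact: regmap_id].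
  have [rth _] := chart_regmap ch.
  exact: (regular_comp (h := fun t => th t j j) rphi wT).
have /choice[a aP] := fun j => chart_character (cphi j).
exists (\matrix_(i, j) a j i), (fun i t => th t i i); first exact: chart_char_basis.
by move=> j t Tt; rewrite aP //; apply: eq_bigr => i _; rewrite mxE.
Qed.

End ChartTheory.

(** The basis chosen in the definition of Phi gives coordinates in which
    conjugation by w is the monomial map of Phi. *)
Lemma Phi_chart r w : torus_of_dim r T -> (forall t, T t -> T (phi w t)) ->
  exists th io, @chart r th io /\
    forall u, Gm K r u -> phi w (io u) = io (gm (Phi T r w) u).
Proof.
move=> hr wT; have [th0 [io0 ch0]] := chart_exists hr.
have [P0 P0P] := pullback_matrix_exists ch0 wT.
have [chi bchi PhiE] : pullback_matrix T w (Phi T r w) by apply: (xgetPex 0); exists P0.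
have [th [io [ch thE]]] := chart_of_basis ch0 bchi.
exists th, io; split=> // u Gu.
have Tu := chart_mem ch Gu; have Tphi := wT _ Tu.
rewrite -[LHS](chartK ch) //; congr (io _).
apply: Gm_eq => [||j]; [exact: (chart_Gm ch)|exact: gm_Gm|].
rewrite thE // PhiE // gmE //; apply: eq_bigr => i _.
by rewrite -thE // (chartVK ch).
Qed.

End Chart.

(** * The kernel of the norm *)

Section Subtorus.
Variables (K : closedFieldType).

(** For u take a c-th root t0; then gm S t0 is mapped by C *m A' to u, because
    S *m C *m A' = c. *)
Lemma gm_image_surj k m rho (C : 'M[int]_(k, m)) (A : 'M[int]_(rho, m))
    (A' : 'M[int]_(m, rho)) (S : 'M[int]_(rho, k)) c :
  (0 < c)%N -> C *m A' *m A = C -> S *m C *m A' = c%:R%:M ->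
  forall u, Gm K rho u -> exists2 t, Gm K k t & gm C t = gm A u.
Proof.
move=> c0 CA SC u Gu; have [t Gt <-] := Gm_root c0 Gu.
exists (gm S t); first exact: gm_Gm.
by rewrite -gm_mulmx // -CA !mulmxA -[S *m C *m A']/(_ *m A') SC gm_mulmx // gm_scalar.
Qed.

Variables (r rho : nat) (A : 'M[int]_(rho, r)) (A' : 'M[int]_(r, rho)).
Hypothesis AA' : A *m A' = 1%:M.

(** The projection onto the kernel of gm A' along the image of gm A, two
    complementary subtori when A *m A' = 1. *)
Definition cproj (v : GL K r) := gm (1%:M - A' *m A) v.

Lemma cprojM u v : Gm K r u -> Gm K r v ->
  cproj (u * v)%g = (cproj u * cproj v)%g.
Proof. exact: gmM. Qed.

Lemma cprojA u : Gm K rho u -> cproj (gm A u) = 1%g.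
Proof.
by move=> Gu; rewrite /cproj -gm_mulmx // mulmxBr mulmx1 mulmxA AA' mul1mx subrr gm0.
Qed.

Lemma cprojA' v : Gm K r v -> gm A' (cproj v) = 1%g.
Proof.
by move=> Gv; rewrite /cproj -gm_mulmx // mulmxBl mul1mx -mulmxA AA' mulmx1 subrr gm0.
Qed.

Lemma cproj_decomp v : Gm K r v -> v = (gm A (gm A' v) * cproj v)%g.
Proof.
by move=> Gv; rewrite -gm_mulmx // -gmD // addrC subrK gm_id.
Qed.

Lemma cproj_fix v : Gm K r v -> gm A' v = 1%g -> cproj v = v.
Proof. by move=> Gv A'v; rewrite {2}(cproj_decomp Gv) A'v gm1 mul1g. Qed.

Definition subcoset (v : GL K r) : set (GL K r) :=
  [set (gm A u * v)%g | u in Gm K rho].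

(** This describes the coset by equations, whence it is closed. *)
Lemma subcosetP v x : Gm K r v ->
  subcoset v x <-> Gm K r x /\ cproj x = cproj v.
Proof.
move=> Gv; split=> [[u Gu <-]|[Gx xv]].
  split; first exact/GmM/Gv/gm_Gm.
  by rewrite cprojM ?cprojA ?mul1g //; exact: gm_Gm.
exists (gm A' (x * v^-1)%g); first exact: gm_Gm.
have Gxv : Gm K r (x * v^-1)%g by apply: GmM => //; exact: GmV.
rewrite -[gm A _]mulg1 -[X in (_ * X * _)%g](_ : cproj (x * v^-1) = 1)%g.
  by rewrite -cproj_decomp // mulgVK.
rewrite cprojM //; last exact: GmV.
by rewrite {2}/cproj gmV // -/(cproj v) xv mulgV.
Qed.

Lemma subcoset_refl v : Gm K r v -> subcoset v v.
Proof. by move=> Gv; apply/subcosetP. Qed.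

Lemma regmap_subcoset v : regmap (Gm K rho) (fun u => gm A u * v)%g.
Proof. by apply: regmapM; [exact: regmap_gm|exact: regmap_cst]. Qed.

Lemma irreducible_subcoset v : irreducible_set (subcoset v).
Proof. by apply: irreducible_image; [exact: irreducible_Gm|exact: regmap_subcoset]. Qed.

Lemma closed_subcoset v : Gm K r v -> closed (subcoset v).
Proof.
move=> Gv.
have -> : subcoset v = [set x | Gm K r x /\ [set cproj v] (cproj x)].
  by apply/seteqP; split=> x /(subcosetP _ Gv).
by apply: closed_regmap; [exact: closed_Gm|exact: regmap_gm|exact: closed_gl1].
Qed.

End Subtorus.

Section NormKernel.
Variables (K : closedFieldType) (r d : nat) (P : 'M[int]_r).
Hypotheses (d0 : (0 < d)%N) (Pd : P ^+ d = 1).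
Local Notation B := (\sum_(i < d) P ^+ i).
Variables (rho : nat) (A : 'M[int]_(rho, r)) (A' : 'M[int]_(r, rho)).
Variables (S : 'M[int]_(rho, r)) (c : nat).
Hypotheses (c0 : (0 < c)%N) (AA' : A *m A' = 1%:M).
Hypotheses (QA : (1%:M - P) *m A' *m A = 1%:M - P).
Hypotheses (SQ : S *m (1%:M - P) *m A' = c%:R%:M).

(** Up to the factor c, the matrix A is S *m (1 - P), and (1 - P) B = 0. *)
Lemma image_norm0 : A *m B = 0.
Proof.
have : c%:R%:M *m (A *m B) = 0.
  have -> : c%:R%:M *m (A *m B) = S *m ((1%:M - P) *m A' *m A *m B).
    by rewrite -SQ !mulmxA.
  rewrite QA.
  by rewrite -[_ *m B]/((1 - P) * B) (norm_subr1 Pd) mulmx0.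
move=> /matrixP cAB; apply/matrixP=> i j; have := cAB i j.
rewrite mul_scalar_mx !mxE => /eqP; rewrite mulf_eq0 natz => /orP[|/eqP//].
by case: (c) c0.
Qed.

(** These represent the components of the kernel of the norm: on each coset of
    the image of gm A the projection cproj takes a single value,
    and on the kernel of the norm this value lies here. *)
Definition kernel_reps : set (GL K r) :=
  [set v | [/\ Gm K r v, gm B v = 1%g & gm A' v = 1%g]].

(** All these elements are d-torsion: d is B plus a multiple of 1 - P, the norm
    of v is 1, and 1 - P factors through A', which kills v. *)
Lemma kernel_reps_finite : finite_set kernel_reps.
Proof.
apply: sub_finite_set (Gm_torsion_finite K r d0) => v [Gv Bv A'v]; split=> //.
have [U [BU QU]] := norm_complement d P.
have vd : (v ^+ d)%g = gm (U *m (1%:M - P)) v.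
  by rewrite -gm_scalar // -BU gmD // Bv mul1g QU.
rewrite vd -QA !mulmxA -2!mulmxA mulmxA gm_mulmx // -vd gm_mulmx ?GmX //.
by rewrite gmX // A'v expg1n gm1.
exact: GmX.
Qed.

Lemma cproj_kernel v : Gm K r v -> gm B v = 1%g -> kernel_reps (cproj A A' v).
Proof.
move=> Gv Bv; split; [exact: gm_Gm| |exact: cprojA'].
by rewrite /cproj -gm_mulmx // mulmxBl mul1mx -mulmxA image_norm0 mulmx0 subr0.
Qed.

Lemma subcoset_kernel v : Gm K r v -> gm B v = 1%g ->
  subcoset A v `<=` ker_gamma K r r B.
Proof.
move=> Gv Bv _ [u Gu <-]; apply/ker_gammaE; split; first exact/GmM/Gv/gm_Gm.
by rewrite gmM //; [rewrite Bv mulg1 -gm_mulmx // image_norm0 gm0|exact: gm_Gm].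
Qed.

(** The coset is irreducible, hence connected.  It is open in the kernel because
    its complement there is a finite union of closed cosets. *)
Lemma kernel_component v : ker_gamma K r r B v ->
  connected_component (ker_gamma K r r B) v = subcoset A v.
Proof.
move=> kv; have /ker_gammaE[Gv Bv] := kv.
have ccov y : ker_gamma K r r B y -> subcoset A (cproj A A' y) y.
  move=> /ker_gammaE[Gy By]; apply/(subcosetP AA'); first exact: gm_Gm.
  by split=> //; rewrite [RHS]cproj_fix // ?cprojA' //; exact: gm_Gm.
apply/seteqP; split; last first.
  apply: connected_component_max.
  - exact: (subcoset_refl AA').
  - exact: subcoset_kernel.
  - exact/irreducible_connected/irreducible_subcoset.
set X := connected_component _ _.
have Xk : X `<=` ker_gamma K r r B by exact: connected_component_sub.
(* The complement of the coset in the kernel, as a finite union of cosets. *)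
pose W := \bigcup_(f in kernel_reps `\ cproj A A' v) subcoset A f.
have cW : closed W.
  apply: closed_bigcup => [|f [[Gf _ _] _]]; last exact: (closed_subcoset AA').
  exact/finite_setD/kernel_reps_finite.
suff <- : X `&` subcoset A v = X by apply: subIsetr.
apply: component_connected.
- by exists v; split; [exact: connected_component_refl|exact: (subcoset_refl AA')].
- exists (~` W); first exact: closed_openC.
  apply/seteqP; split=> y [Xy yv]; split=> //.
    move=> [f [[Gf _ A'f] fv]] /(subcosetP AA' _ Gf)[_ yf].
    have [_ yv'] := (subcosetP AA' _ Gv).1 yv.
    by apply: fv; rewrite /= -yv' yf cproj_fix.
  apply/(subcosetP AA') => //; have /ker_gammaE[Gy By] := Xk _ Xy; split=> //.
  apply: contrapT => yv'; apply: yv; exists (cproj A A' y); last exact/ccov/Xk.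
  by split=> //; exact: cproj_kernel.
- by exists (subcoset A v) => //; exact: (closed_subcoset AA').
Qed.

Lemma enumerates_kernel_reps :
  exists e : 'I_(multiplicity_mx K r r B) -> GL K r, enumerates e kernel_reps.
Proof.
have [e eF] := finite_enumerates kernel_reps_finite.
suff -> : multiplicity_mx K r r B = ncard kernel_reps by exists e.
apply: (@enumerates_ncard _ _ (fun i => subcoset A (e i))).
have [einj eP] := eF.
have eFi i : kernel_reps (e i) by apply/eP; exists i.
have ek i : ker_gamma K r r B (e i).
  by have [Ge Be _] := eFi i; apply/ker_gammaE.
split=> [i j eij|Y].
  apply: einj; have [Gi _ A'i] := eFi i; have [Gj _ A'j] := eFi j.
  have : subcoset A (e j) (e i) by rewrite -eij; exact: (subcoset_refl AA').
  by move=> /(subcosetP AA' _ Gj)[_]; rewrite !cproj_fix.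
split=> [[v kv <-]|[i <-]]; last by exists (e i) => //; exact: kernel_component.
have /ker_gammaE[Gv Bv] := kv.
have /eP[i ei] := cproj_kernel Gv Bv; exists i; rewrite ei kernel_component //.
have Gp : Gm K r (cproj A A' v) by exact: gm_Gm.
have pp : cproj A A' (cproj A A' v) = cproj A A' v by rewrite cproj_fix // cprojA'.
apply/seteqP; split=> y /(subcosetP AA')[]// Gy yv; apply/(subcosetP AA') => //.
  by rewrite yv pp.
by rewrite yv pp.
Qed.

End NormKernel.

(** * Orders and conjugacy in a coset of the torus *)

Section WeylCoset.
Variables (K : closedFieldType) (n r : nat) (T w : set (GL K n)).
Variables (th : GL K n -> GL K r) (io : GL K r -> GL K n) (P : 'M[int]_r).
Hypothesis ch : chart T th io.
Hypothesis w0 : w !=set0.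
Hypothesis wE : forall x y, w x -> w y <-> exists2 u, Gm K r u & y = (io u * x)%g.
Hypothesis wconj : forall x u, w x -> Gm K r u -> (x * io u = io (gm P u) * x)%g.

Let wM x u : w x -> Gm K r u -> w (io u * x)%g.
Proof. by move=> wx Gu; apply/(wE _ wx); exists u. Qed.

Lemma coset_powE x k : w x ->
  coset_pow T w k = [set (t * x ^+ k)%g | t in T].
Proof.
move=> wx; elim: k => [|k IH].
  by apply/seteqP; split=> t; [exists t; rewrite ?mulg1|case=> s Ts <-; rewrite mulg1].
rewrite /coset_pow iterS -/(coset_pow T w k) IH; apply/seteqP; split=> y.
  case=> _ /(wE _ wx)[u Gu ->] [_ [t Tt <-] <-].
  have Gt := chart_Gm ch Tt; rewrite -(chartK ch Tt).
  exists (io u * io (gm P (th t)))%g.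
    by apply: (chart_mulT ch); apply: (chart_mem ch) => //; exact: gm_Gm.
  by rewrite expgS !mulgA; congr (_ * _)%g; rewrite -!mulgA wconj.
case=> t Tt <-; exists (t * x)%g.
  by rewrite -(chartK ch Tt); apply: wM => //; exact: (chart_Gm ch).
exists (x ^+ k)%g; last by rewrite expgS mulgA.
by exists 1%g; [exact: (chart_T1 ch)|rewrite mul1g].
Qed.

Lemma coset_powT x k : w x -> coset_pow T w k = T <-> T (x ^+ k)%g.
Proof.
move=> wx; rewrite (coset_powE k wx); split=> [wT|Txk].
  by rewrite -wT; exists 1%g; [exact: (chart_T1 ch)|rewrite mul1g].
apply/seteqP; split=> [_ [t Tt <-]|t Tt]; first exact: (chart_mulT ch).
exists (t * (x ^+ k)^-1)%g; last by rewrite mulgVK.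
by apply: (chart_mulT ch) => //; exact: (chart_TV ch).
Qed.

(** Moving the factors x to the right past elements of T lets powers of P act on
    u. *)
Lemma expg_coset x u j : w x -> Gm K r u ->
  ((io u * x) ^+ j = io (gm (\sum_(i < j) P ^+ i) u) * x ^+ j)%g.
Proof.
move=> wx Gu; elim: j => [|j IH].
  by rewrite !expg0 big_ord0 gm0 // (chart_io1 ch) mulg1.
have -> : \sum_(i < j.+1) P ^+ i = 1%:M + (\sum_(i < j) P ^+ i) *m P.
  rewrite big_ord_recl expr0 /= -[_ *m P]/(_ * P) mulr_suml; congr (_ + _).
  by apply: eq_bigr => i _; rewrite exprSr.
rewrite expgS IH gmD // gm_id // gm_mulmx // (chartM ch) //; last exact: gm_Gm.
by rewrite expgS -!mulgA; congr (_ * _)%g; rewrite !mulgA wconj //; exact: gm_Gm.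
Qed.

Section FiniteOrder.
Variable d : nat.
Hypothesis d0 : (0 < d)%N.
Hypothesis dE : order_weyl T w = d.

Lemma order_weylP x j : w x -> T (x ^+ j)%g <-> (d %| j)%N.
Proof.
move=> wx; have [] := @least_gt0 [set k | (0 < k)%N /\ coset_pow T w k = T].
  by rewrite -/(order_weyl T w) dE.
rewrite -/(order_weyl T w) dE => -[_ /(coset_powT _ wx) Txd] dmin.
have TX k : T ((x ^+ d) ^+ k)%g.
  elim: k => [|k IH]; first exact: (chart_T1 ch).
  by rewrite expgS; apply: (chart_mulT ch).
split=> [Txj|/dvdnP[q ->]]; last by rewrite mulnC expgnA.
rewrite /dvdn -leqn0 leqNgt; apply/negP => jk.
suff: (d <= j %% d)%N by rewrite leqNgt ltn_mod d0.
apply: dmin; split=> //; apply/(coset_powT _ wx).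
rewrite -[(x ^+ _)%g](mulKg ((x ^+ d) ^+ (j %/ d))%g) -expgnA mulnC -expgnDr -divn_eq.
apply: (chart_mulT ch) => //; apply: (chart_TV ch).
by rewrite mulnC expgnA.
Qed.

(** The element x ^+ d lies in the commutative group T, so it acts trivially on
    T. *)
Lemma period : P ^+ d = 1.
Proof.
have [x wx] := w0; have Txd : T (x ^+ d)%g by apply/order_weylP.
apply: (@gm_inj K) => u Gu; rewrite -[1]/(1%:M) gm_id //.
apply: (chart_io_inj ch); [exact: gm_Gm|exact: Gu|].
apply: (mulIg (x ^+ d)%g); rewrite [RHS](chart_mulTC ch (chart_mem ch Gu) Txd).
have xj j : (x ^+ j * io u = io (gm (P ^+ j) u) * x ^+ j)%g.
  elim: j => [|j IH]; first by rewrite gm_id // !expg0 mul1g mulg1.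
  rewrite expgS -mulgA IH mulgA wconj //; last exact: gm_Gm.
  by rewrite -gm_mulmx // -mulgA exprSr.
by rewrite xj.
Qed.

Local Notation B := (\sum_(i < d) P ^+ i).

Lemma expg_period x u j : w x -> Gm K r u ->
  ((io u * x) ^+ (d * j) = io (gm B u ^+ j) * x ^+ (d * j))%g.
Proof.
move=> wx Gu; rewrite expgnA expg_coset // expgMn -?expgnA.
  by rewrite (chart_ioX ch) //; exact: gm_Gm.
apply: (chart_mulTC ch); last exact/order_weylP.
by apply: (chart_mem ch); exact: gm_Gm.
Qed.

(** The image of the norm is divisible: for a suitable root t of u^-1, the norm of t
    contributes to (io t * x) ^+ j the inverse of x ^+ j. *)
Lemma kill_power x j u : w x -> (0 < j)%N -> (d %| j)%N -> Gm K r u ->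
  (x ^+ j = io (gm B u))%g -> exists2 y, w y & (y ^+ j)%g = 1%g.
Proof.
move=> wx j0 /dvdnP[q jq] Gu xj; subst j; rewrite mulnC in j0 xj *.
have q0 : (0 < q)%N by move: j0; rewrite muln_gt0 => /andP[].
have [t Gt tq] := Gm_root q0 (GmV Gu).
exists (io t * x)%g; first exact: wM.
rewrite expg_period // xj -(chartM ch); [|exact/GmX/gm_Gm|exact: gm_Gm].
by rewrite -gmX // tq gmV // mulVg (chart_io1 ch).
Qed.

End FiniteOrder.

Lemma order_weyl_gt0 x k : w x -> (0 < k)%N -> (x ^+ k)%g = 1%g ->
  (0 < order_weyl T w)%N.
Proof.
move=> wx k0 xk; have [] := @leastP [set k | (0 < k)%N /\ coset_pow T w k = T].
  by exists k; split=> //; apply/(coset_powT _ wx); rewrite xk; exact: (chart_T1 ch).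
by rewrite -/(order_weyl T w) => -[].
Qed.

Lemma min_orderP : (0 < min_order w)%N ->
  (exists2 x, w x & order_elt x = min_order w) /\
  forall y k, w y -> (0 < k)%N -> (y ^+ k)%g = 1%g -> (min_order w <= k)%N.
Proof.
move=> D0; have [] := least_gt0 D0; rewrite -/(min_order w) => -[_ ex] Dmin.
split=> // y k wy k0 yk; have [o0 oP] := order_elt_fin k0 yk.
apply: (@leq_trans (order_elt y)); first by apply: Dmin; split=> //; exists y.
by apply: dvdn_leq => //; apply/oP.
Qed.

(** Let x have the minimal order D and let y ^+ k = 1.  Then x ^+ k = x ^+ (k %% D)
    lies in the image of the norm, so some z in the coset has
    z ^+ (k %% D) = 1; by minimality of D this exponent is zero. *)
Lemma min_order_dvd k : (0 < k)%N -> ~~ (min_order w %| k)%N ->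
  elts_of_order k w = set0.
Proof.
move=> k0 Dk; apply/seteqP; split=> // y [wy yk].
have yk1 := order_elt_eq0 k0 yk.
have D0 : (0 < min_order w)%N.
  have [] := @leastP [set k | (0 < k)%N /\ exists2 x, w x & order_elt x = k].
    by exists k; split=> //; exists y.
  by rewrite -/(min_order w) => -[].
have [[x wx xD] Dmin] := min_orderP D0.
have xD1 := order_elt_eq0 D0 xD.
set D := min_order w in Dk D0 xD Dmin xD1.
have d0 := order_weyl_gt0 wx D0 xD1.
set d := order_weyl T w in d0.
have ow := order_weylP d0 (erefl d).
have dk : (d %| k)%N by apply/(ow _ _ wy); rewrite yk1; exact: (chart_T1 ch).
have dD : (d %| D)%N by apply/(ow _ _ wx); rewrite xD1; exact: (chart_T1 ch).
have m0 : (0 < k %% D)%N by rewrite lt0n -/(dvdn D k).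
have dm : (d %| k %% D)%N.
  by move: dk; rewrite {1}(divn_eq k D) dvdn_addr // dvdn_mull.
have xm : (x ^+ (k %% D) = x ^+ k)%g.
  by rewrite [in RHS](divn_eq k D) expgnDr mulnC expgnA xD1 expg1n mul1g.
have [u Gu yE] := (wE y wx).1 wy.
have [q kq] := dvdnP dk; rewrite mulnC in kq.
have xk : (x ^+ k)%g = io (gm (\sum_(i < d) P ^+ i) (u^-1 ^+ q)%g).
  apply: (mulgI (io (gm (\sum_(i < d) P ^+ i) u ^+ q)%g)).
  rewrite {1}kq -(expg_period d0 (erefl d)) // -yE -kq yk1.
  rewrite -(chartM ch); [|exact/GmX/gm_Gm|exact: gm_Gm].
  rewrite -gmX // -gmM; [|exact: GmX|exact/GmX/GmV].
  by rewrite -expgMn ?mulgV ?expg1n ?gm1 ?(chart_io1 ch) // /commute mulgV mulVg.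
have [||z wz zm] := @kill_power d d0 (erefl d) x (k %% D) (u^-1 ^+ q)%g wx m0 dm.
- exact/GmX/GmV.
- by rewrite xm.
have := Dmin z _ wz m0 zm.
by rewrite leqNgt ltn_mod D0.
Qed.

Section Decomposition.
Variable d : nat.
Hypothesis d0 : (0 < d)%N.
Hypothesis dE : order_weyl T w = d.
Local Notation B := (\sum_(i < d) P ^+ i).
Let Pd : P ^+ d = 1 := period d0 dE.
Let owP := order_weylP d0 dE.

(** For y in the coset, y ^+ j is in T only if d divides j. *)
Lemma order_coset y m : w y -> (0 < m)%N ->
  order_elt y = (d * m)%N <-> forall q, (y ^+ (d * q))%g = 1%g <-> (m %| q)%N.
Proof.
move=> wy m0; have dm0 : (0 < d * m)%N by rewrite muln_gt0 d0.
split=> [/(order_eltP _ dm0) h q|h].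
  by rewrite h dvdn_pmul2l.
apply/(order_eltP _ dm0) => j; split=> [yj|/dvdnP[q ->]]; last first.
  by rewrite mulnCA; apply/h; exact: dvdn_mull.
have /dvdnP[q jq] : (d %| j)%N by apply/(owP _ wy); rewrite yj; exact: (chart_T1 ch).
by move: yj; rewrite jq mulnC h dvdn_pmul2l.
Qed.

Variables (rho : nat) (A : 'M[int]_(rho, r)) (A' : 'M[int]_(r, rho)).
Variables (S : 'M[int]_(rho, r)) (c : nat).
Hypotheses (c0 : (0 < c)%N) (AA' : A *m A' = 1%:M).
Hypotheses (QA : (1%:M - P) *m A' *m A = 1%:M - P).
Hypotheses (SQ : S *m (1%:M - P) *m A' = c%:R%:M).

Variables (sig : nat) (A1 : 'M[int]_(sig, r)) (A1' : 'M[int]_(r, sig)).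
Variables (S1 : 'M[int]_(sig, r)) (c1 : nat).
Hypotheses (c10 : (0 < c1)%N) (AA1' : A1 *m A1' = 1%:M).
Hypotheses (BA1 : B *m A1' *m A1 = B).
Hypotheses (SB : S1 *m B *m A1' = c1%:R%:M).

(** Coordinates of the norm of u in the image of the norm, which is a torus of
    dimension sig with parametrization gm A1. *)
Definition ncoord (u : GL K r) : GL K sig := gm A1' (gm B u).

Lemma ncoord_Gm u : Gm K sig (ncoord u).
Proof. exact: gm_Gm. Qed.

Lemma norm_ncoord u : Gm K r u -> gm B u = gm A1 (ncoord u).
Proof. by move=> Gu; rewrite -{1}BA1 !gm_mulmx. Qed.

Lemma norm_exp_eq1 u q : Gm K r u ->
  (gm B u ^+ q)%g = 1%g <-> (ncoord u ^+ q)%g = 1%g.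
Proof.
move=> Gu; split=> [h|h].
  by rewrite /ncoord -gmX ?h ?gm1 //; exact: gm_Gm.
by rewrite norm_ncoord // -gmX ?h ?gm1 //; exact: ncoord_Gm.
Qed.

Lemma coset_exp_eq1 x u q : w x -> (x ^+ d)%g = 1%g -> Gm K r u ->
  ((io u * x) ^+ (d * q))%g = 1%g <-> (ncoord u ^+ q)%g = 1%g.
Proof.
move=> wx xd Gu; rewrite (expg_period d0 dE) // expgnA xd expg1n mulg1.
rewrite -norm_exp_eq1 //; split=> [h|->]; last exact: (chart_io1 ch).
by apply: (chart_io_inj ch); [exact/GmX/gm_Gm|exact: Gm1|rewrite h (chart_io1 ch)].
Qed.

(** If q is odd, then x ^+ (d * q) = x ^+ d, and this element is not in the image
    of the norm, since otherwise the coset would contain some y with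
    y ^+ d = 1. *)
Lemma coset_exp_eq1_twisted x u q : min_order w = (2 * d)%N ->
  w x -> order_elt x = (2 * d)%N -> Gm K r u ->
  ((io u * x) ^+ (d * q))%g = 1%g <-> (2 %| q)%N /\ (ncoord u ^+ q)%g = 1%g.
Proof.
move=> wD wx ox Gu; have D0 : (0 < 2 * d)%N by rewrite muln_gt0.
have xD := order_elt_eq0 D0 ox.
rewrite (expg_period d0 dE) // -norm_exp_eq1 //.
have [qe|qo] := boolP (2 %| q)%N; last first.
  split=> [h|[]//]; exfalso.
  (* x ^+ (2 * d) = 1 and q is odd. *)
  have xdE : (x ^+ (d * q) = x ^+ d)%g.
    have -> : q = (q./2).*2.+1.
      by move: qo; rewrite dvdn2 negbK -{2}[q]odd_double_half => ->.
    by rewrite mulnS -mul2n mulnA (mulnC d 2) expgnDr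
      [X in (_ * X)%g]expgnA xD expg1n mulg1.
  have Gn : Gm K r (gm B u) by exact: gm_Gm.
  have [||y wy yd] := @kill_power d d0 dE x d (u^-1 ^+ q)%g wx d0 (dvdnn d).
  - exact/GmX/GmV.
  - apply: (mulgI (io (gm B u ^+ q)%g)); rewrite -{1}xdE h -(chartM ch); first last.
    + exact: gm_Gm.
    + exact: GmX.
    rewrite gmX; last exact: GmV.
    by rewrite gmV // expVgn mulgV (chart_io1 ch).
  have D0' : (0 < min_order w)%N by rewrite wD.
  have [_ Dmin] := min_orderP D0'.
  by have := Dmin y d wy d0 yd; rewrite wD -{2}[d]mul1n leq_pmul2r.
split=> [h|[_ h]].
  split=> //; apply: (chart_io_inj ch); [exact/GmX/gm_Gm|exact: Gm1|].
  rewrite (chart_io1 ch) -[LHS]mulg1 -[X in (_ * X)%g](_ : x ^+ (d * q) = 1)%g //.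
  by case/dvdnP: qe => q' ->; rewrite mulnCA expgnA mulnC expgnAC xD expg1n.
rewrite h (chart_io1 ch) mul1g.
by case/dvdnP: qe => q' ->; rewrite mulnCA mulnC expgnA mulnC xD expg1n.
Qed.

(** Conjugation by io v multiplies the coordinates by gm (1 - P) v, and these
    factors run over the image of gm A. *)
Lemma orbit_coset x a : w x -> Gm K r a ->
  [set (io (gm A u * a) * x)%g | u in Gm K rho] =
  [set (t * (io a * x) * t^-1)%g | t in T].
Proof.
move=> wx Ga.
have conjE v : Gm K r v ->
    (io v * (io a * x) * (io v)^-1 = io (gm (1%:M - P) v * a) * x)%g.
  move=> Gv; have GPv : Gm K r (gm P v) by exact: gm_Gm.
  have GPv' := GmV GPv.
  rewrite -(chart_ioV ch) // -!mulgA wconj //; last exact: GmV.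
  rewrite gmV // mulgA mulgA -(chartM ch) // -(chartM ch) //; last exact: GmM.
  congr (io _ * _)%g; rewrite gmD // gm_id // gmN // -!mulgA; congr (_ * _)%g.
  exact: Gm_mulC.
apply/seteqP; split=> [_ [u Gu <-]|_ [t Tt <-]].
  have [v Gv <-] := gm_image_surj c0 QA SQ Gu.
  by exists (io v); [exact: (chart_mem ch)|exact: conjE].
have Gt := chart_Gm ch Tt; rewrite -{1 2}(chartK ch Tt).
exists (gm A' (gm (1%:M - P) (th t))); first exact: gm_Gm.
have -> : gm A (gm A' (gm (1%:M - P) (th t))) = gm (1%:M - P) (th t).
  by rewrite -{2}QA !gm_mulmx.
exact/esym/conjE.
Qed.

Lemma closed_coset x a : Gm K r a ->
  closed [set (io (gm A u * a) * x)%g | u in Gm K rho].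
Proof.
move=> Ga.
have ra (X : set (GL K n)) : regmap X (fun y => y * x^-1)%g.
  by apply: regmapM; [exact: regmap_id|exact: regmap_cst].
pose X := [set y | setT y /\ T (y * x^-1)%g].
have cX : closed X.
  by apply: closed_regmap; [exact: closedT|exact: ra|exact: (chart_closed ch)].
have XT y : X y -> T (y * x^-1)%g by case.
have rX := regmap_comp (ra X) XT (chart_regmap ch).
have -> : [set (io (gm A u * a) * x)%g | u in Gm K rho] =
    [set y | X y /\ subcoset A a (th (y * x^-1)%g)].
  apply/seteqP; split=> [_ [u Gu <-]|y [Xy [u Gu uy]]].
    have Gua : Gm K r (gm A u * a)%g by apply: GmM => //; exact: gm_Gm.
    rewrite /X /= mulgK (chartVK ch) //; split; last by exists u.
    by split=> //; exact: (chart_mem ch).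
  by exists u => //; rewrite uy (chartK ch) ?mulgVK //; exact: XT.
by apply: closed_regmap => //; exact: (closed_subcoset AA').
Qed.

Lemma regmap_coset x a : Gm K r a ->
  regmap (Gm K rho) (fun u => io (gm A u * a) * x)%g.
Proof.
move=> Ga; apply: regmapM; last exact: regmap_cst.
apply: (regmap_comp (regmap_subcoset A a) _ (chartV_regmap ch)) => u Gu.
by apply: GmM => //; exact: gm_Gm.
Qed.

Lemma iso_coset x a : Gm K r a ->
  iso_var [set (io (gm A u * a) * x)%g | u in Gm K rho] (Gm K rho).
Proof.
move=> Ga; set C := [set _ | _ in _].
have Gua u : Gm K rho u -> Gm K r (gm A u * a)%g.
  by move=> Gu; apply: GmM => //; exact: gm_Gm.
pose f y := gm A' (th (y * x^-1) * a^-1)%g.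
have fK u : Gm K rho u -> f (io (gm A u * a) * x)%g = u.
  move=> Gu; rewrite /f mulgK (chartVK ch) ?mulgK; last exact: Gua.
  by rewrite -gm_mulmx // AA' gm_id.
have CT y : C y -> T (y * x^-1)%g.
  by move=> [u Gu <-]; rewrite mulgK; apply: (chart_mem ch); exact: Gua.
exists f; split.
  split=> [y _|]; first exact: gm_Gm.
  have rx : regmap C (fun y => y * x^-1)%g.
    by apply: regmapM; [exact: regmap_id|exact: regmap_cst].
  have rC : regmap C (fun y => th (y * x^-1) * a^-1)%g.
    by apply: regmapM (regmap_comp rx CT (chart_regmap ch)) (regmap_cst _ _).
  have GC y : C y -> Gm K r (th (y * x^-1) * a^-1)%g.
    by move=> /CT Ty; apply: GmM (chart_Gm ch Ty) (GmV Ga).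
  exact: (regmap_comp rC GC (regmap_gm K A')).1.
exists (fun u => io (gm A u * a) * x)%g; split=> [|_ [u Gu <-]|u Gu].
- by split=> [u Gu|]; [exists u|exact: (regmap_coset x Ga).1].
- by rewrite fK.
- exact: fK.
Qed.

(** The orbits are indexed by the components of the kernel of the norm, represented
    by f i, and by the coordinates e j of the norm, realized by us j. *)
Lemma fiber_decomposition x N (e : 'I_N -> GL K sig) (Z : set (GL K sig)) :
  w x -> enumerates e Z -> Z `<=` Gm K sig ->
  orbit_decomposition T w
    [set y | exists2 u, Gm K r u & y = (io u * x)%g /\ Z (ncoord u)]
    (multiplicity_mx K r r B * N) rho.
Proof.
move=> wx [einj eZ] ZG.
have AB0 : A *m B = 0 := image_norm0 Pd c0 QA SQ.
have [f [finj fF]] := enumerates_kernel_reps K d0 Pd c0 AA' QA SQ.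
set m := multiplicity_mx _ _ _ _ in f finj fF *.
have fP i : kernel_reps d P A' (f i) by apply/fF; exists i.
have fG i : Gm K r (f i) by case: (fP i).
have eG j : Gm K sig (e j) by apply/ZG/eZ; exists j.
have /choice[us usP] : forall j, exists u, Gm K r u /\ gm B u = gm A1 (e j).
  by move=> j; have [u Gu ue] := gm_image_surj c10 BA1 SB (eG j); exists u.
have usG j : Gm K r (us j) by case: (usP j).
have ncoordM u v : Gm K r u -> Gm K r v -> ncoord (u * v)%g = (ncoord u * ncoord v)%g.
  by move=> Gu Gv; rewrite /ncoord !gmM //; exact: gm_Gm.
have ncoord_us j : ncoord (us j) = e j.
  by rewrite /ncoord (usP j).2 -gm_mulmx // AA1' gm_id.
have ncoord1 u : gm B u = 1%g -> ncoord u = 1%g by rewrite /ncoord => ->; exact: gm1.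
have ncoordA u : Gm K rho u -> ncoord (gm A u) = 1%g.
  by move=> Gu; apply: ncoord1; rewrite -gm_mulmx // AB0 gm0.
have ncoordf i : ncoord (f i) = 1%g by apply: ncoord1; case: (fP i).
pose a i j := (f i * us j)%g.
have aG i j : Gm K r (a i j) by exact: GmM.
have ncoord_a u i j : Gm K rho u -> ncoord (gm A u * a i j)%g = e j.
  move=> Gu; rewrite ncoordM //; last exact: gm_Gm.
  by rewrite ncoordA // mul1g ncoordM // ncoordf mul1g ncoord_us.
(* The pairs (i, j) are numbered like the entries of a matrix. *)
have [g gK1' gK2'] := curry_mxvec_bij m N.
have gK1 i j : g (mxvec_index i j) = (i, j) by exact: (gK1' (i, j)).
have gK2 k : uncurry (@mxvec_index m N) (g k) = k by exact: gK2'.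
exists (fun k => [set (io (gm A u * a (g k).1 (g k).2) * x)%g | u in Gm K rho]).
split.
- apply/seteqP; split=> [y [u Gu [yE Zu]]|y [k _ [u Gu <-]]].
    have [j ej] := (eZ _).1 Zu.
    have Gv : Gm K r (u * (us j)^-1)%g by apply: GmM => //; exact: GmV.
    have Bv : gm B (u * (us j)^-1)%g = 1%g.
      rewrite gmM ?gmV //; last exact: GmV.
      by rewrite (usP j).2 ej norm_ncoord // mulgV.
    have [i fi] := (fF _).1 (cproj_kernel Pd c0 AA' QA SQ Gv Bv).
    exists (mxvec_index i j) => //; exists (gm A' (u * (us j)^-1)%g); first exact: gm_Gm.
    rewrite gK1 /= /a fi.
    by rewrite mulgA -cproj_decomp // mulgVK yE.
  exists (gm A u * a (g k).1 (g k).2)%g; first by apply: GmM => //; exact: gm_Gm.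
  by split=> //; rewrite ncoord_a //; apply/eZ; exists (g k).2.
- move=> k l _ _ [y [[u Gu uy] [v Gv vy]]].
  have Gua i j s : Gm K rho s -> Gm K r (gm A s * a i j)%g.
    by move=> Gs; apply: GmM => //; exact: gm_Gm.
  have uv : (gm A u * a (g k).1 (g k).2 = gm A v * a (g l).1 (g l).2)%g.
    apply: (chart_io_inj ch); [exact: Gua|exact: Gua|].
    by apply: (mulIg x); rewrite uy.
  have e2 : (g k).2 = (g l).2.
    by apply: einj; rewrite -(ncoord_a u (g k).1) // uv ncoord_a.
  have e1 : (g k).1 = (g l).1.
    apply: finj; move: uv; rewrite /a e2 !mulgA => /mulIg /(congr1 (cproj A A')).
    have cf i : cproj A A' (f i) = f i by apply: cproj_fix => //; case: (fP i).
    rewrite !cprojM //; try exact: gm_Gm.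
    by rewrite !cprojA // !mul1g !cf.
  rewrite -(gK2 k) -(gK2 l); congr (uncurry _ _).
  by case: (g k) (g l) e1 e2 => ? ? [? ?] /= -> ->.
move=> k; split.
- exact: (irreducible_image (irreducible_Gm K rho) (regmap_coset x (aG _ _))).
- exact: closed_coset.
- exact: iso_coset.
- exists (io (a (g k).1 (g k).2) * x)%g; last exact: orbit_coset.
  by apply/(wE _ wx); exists (a (g k).1 (g k).2).
Qed.

End Decomposition.
End WeylCoset.

(** * The component attached to an element of the Weyl group *)

Section Assembly.
Variables (K : closedFieldType) (n r : nat) (T w : set (GL K n)).
Variables (th : GL K n -> GL K r) (io : GL K r -> GL K n).
Local Notation P := (Phi T r w).
Hypothesis ch : chart T th io.
Hypothesis w0 : w !=set0.
Hypothesis wE : forall x y, w x -> w y <-> exists2 u, Gm K r u & y = (io u * x)%g.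
Hypothesis wconj : forall x u, w x -> Gm K r u -> (x * io u = io (gm P u) * x)%g.

Lemma orbit_decomposition_eq D1 D2 N q : D1 `<=>` D2 ->
  orbit_decomposition T w D1 N q -> orbit_decomposition T w D2 N q.
Proof. by move=> /seteqP ->. Qed.

(** The map nc is the norm in coordinates on its image, a torus of dimension
    sigma(w).  Its properties sum up what the factorizations of 1 - P and B give. *)
Lemma decomposition_by_norm x : w x -> (0 < order_weyl T w)%N ->
  exists nc : GL K r -> GL K (sigma T r w),
    [/\ forall u q, (x ^+ order_weyl T w)%g = 1%g -> Gm K r u ->
          ((io u * x) ^+ (order_weyl T w * q))%g = 1%g <-> (nc u ^+ q)%g = 1%g,
        forall u q, min_order w = (2 * order_weyl T w)%N ->
          order_elt x = (2 * order_weyl T w)%N -> Gm K r u ->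
          ((io u * x) ^+ (order_weyl T w * q))%g = 1%g <->
          (2 %| q)%N /\ (nc u ^+ q)%g = 1%g,
        forall u, Gm K (sigma T r w) (nc u) &
        forall N (e : 'I_N -> GL K (sigma T r w)) Z, enumerates e Z ->
          Z `<=` Gm K (sigma T r w) ->
          orbit_decomposition T w
            [set y | exists2 u, Gm K r u & y = (io u * x)%g /\ Z (nc u)]
            (multiplicity T r w * N) (r - sigma T r w)].
Proof.
move=> wx d0; have Pd := period ch w0 wE wconj d0 erefl.
have [rho [A [A' [S [c [c0 AA' QA SQ]]]]]] := int_image_factor (1%:M - P).
have [sig [A1 [A1' [S1 [c1 [c10 AA1' BA1 SB]]]]]] :=
  int_image_factor (\sum_(i < order_weyl T w) P ^+ i).
have rhoE := image_factor_rank c0 QA SQ.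
have := image_factor_rank c10 BA1 SB; rewrite (rank_norm d0 Pd).
rewrite -/(sigma T r w) => sigE; subst sig.
have -> : (r - sigma T r w)%N = rho.
  rewrite /sigma rank_eigenspace1 rhoE subKn // -rhoE; exact: rank_leq_row.
exists (ncoord P (order_weyl T w) A1'); split.
- move=> u q xd Gu; exact: (coset_exp_eq1 ch wE wconj d0 erefl BA1).
- move=> u q wD ox Gu; exact: (coset_exp_eq1_twisted ch wE wconj d0 erefl BA1 _ wD wx ox).
- by move=> u; exact: ncoord_Gm.
- move=> N e Z eZ ZG.
  exact: (fiber_decomposition ch w0 wE wconj d0 erefl c0 AA' QA SQ c10 AA1' BA1 SB wx eZ ZG).
Qed.

Lemma decomposition_split k s : (0 < k)%N ->
  min_order w = order_weyl T w -> k = (min_order w * s)%N ->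
  orbit_decomposition T w (elts_of_order k w)
    (multiplicity T r w * nu K s (sigma T r w)) (r - sigma T r w).
Proof.
move=> k0 wd kE; have [d0 s0] : (0 < order_weyl T w)%N /\ (0 < s)%N.
  by apply/andP; rewrite -muln_gt0 -wd -kE.
have D0 : (0 < min_order w)%N by rewrite wd.
have [[x wx ox] _] := min_orderP D0.
have xd := order_elt_eq0 D0 ox; rewrite wd in xd.
have [nc [ncP _ ncG dec]] := decomposition_by_norm wx d0.
have [e eZ] := enumerates_nu K (sigma T r w) s0.
have := dec _ _ _ eZ (fun t h => h.1).
apply: orbit_decomposition_eq; split=> y.
  move=> [u Gu [-> [_ onc]]]; have wy : w (io u * x)%g by apply/(wE _ wx); exists u.
  split=> //; rewrite kE wd; apply/(order_coset ch wE wconj d0 erefl wy s0) => q.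
  by rewrite ncP //; exact: (order_eltP _ s0).1.
move=> [wy oy]; have [u Gu yE] := (wE y wx).1 wy; exists u => //; split=> //.
split; first exact: ncG.
apply/(order_eltP _ s0) => q; rewrite -ncP // -yE.
by apply: (order_coset ch wE wconj d0 erefl wy s0).1; rewrite oy kE wd.
Qed.

(** Here the coordinates of the norm have order 2 s, or order s if s is odd. *)
Lemma decomposition_twisted k s : (0 < k)%N ->
  min_order w = (2 * order_weyl T w)%N -> k = (min_order w * s)%N ->
  orbit_decomposition T w (elts_of_order k w)
    (multiplicity T r w *
       (if odd s then nu K s (sigma T r w) + nu K (2 * s) (sigma T r w)
        else nu K (2 * s) (sigma T r w))) (r - sigma T r w).
Proof.
move=> k0 wd kE.
have [D0 s0] : (0 < min_order w)%N /\ (0 < s)%N.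
  by apply/andP; rewrite -muln_gt0 -kE.
have d0 : (0 < order_weyl T w)%N by move: D0; rewrite wd muln_gt0.
have s20 : (0 < 2 * s)%N by rewrite muln_gt0.
have [[x wx ox] _] := min_orderP D0; rewrite wd in ox.
have [nc [_ ncP ncG dec]] := decomposition_by_norm wx d0.
pose Z := [set t : GL K (sigma T r w) | Gm K (sigma T r w) t /\
  (order_elt t = (2 * s)%N \/ (odd s /\ order_elt t = s))].
have [N [NE [e eZ]]] : exists N, N = (if odd s then
    nu K s (sigma T r w) + nu K (2 * s) (sigma T r w)
    else nu K (2 * s) (sigma T r w))%N /\
    exists e : 'I_N -> GL K (sigma T r w), enumerates e Z.
  have [e2 eZ2] := enumerates_nu K (sigma T r w) s20.
  eexists; split; first by [].
  have [so|se] := boolP (odd s); last first.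
    exists e2; case: eZ2 => inj2 eZ2; split=> // t; rewrite -eZ2.
    by split=> [[Gt [|[]]]|[Gt ?]] //; rewrite ?(negPf se) //; split=> //; left.
  have [e1 eZ1] := enumerates_nu K (sigma T r w) s0.
  have [|e [einj eU]] := enumeratesU eZ1 eZ2.
    by move=> t [_ o1] [_]; rewrite o1 => /eqP; rewrite -{1}[s]mul1n eqn_pmul2r.
  exists e; split=> // t; rewrite -eU.
  split=> [[Gt [o|[_ o]]]|[[Gt o]|[Gt o]]]; [by right|by left| |].
    by split=> //; right.
  by split=> //; left.
rewrite -NE; have := dec _ _ _ eZ (fun t h => h.1).
apply: orbit_decomposition_eq; rewrite wd (mulnC 2%N) -mulnA in kE.
split=> y.
  move=> [u Gu [-> [_ onc]]]; have wy : w (io u * x)%g by apply/(wE _ wx); exists u.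
  split=> //; rewrite kE; apply/(order_coset ch wE wconj d0 erefl wy s20) => q.
  by rewrite ncP //; exact: (order_even_power _ s0).2.
move=> [wy oy]; have [u Gu yE] := (wE y wx).1 wy; exists u => //; split=> //.
split; first exact: ncG.
apply/(order_even_power _ s0) => q; rewrite -ncP // -yE.
by apply: (order_coset ch wE wconj d0 erefl wy s20).1; rewrite oy kE.
Qed.

End Assembly.

Section WeylComponent.
Variables (K : closedFieldType) (n r : nat) (G T w : set (GL K n)).
Hypothesis hr : torus_of_dim r T.
Hypothesis hw : weyl G T w.

(** Conjugation by an element of the coset w acts on T independently of this
    element because T is commutative. *)
Lemma weyl_chart : exists th io,
  [/\ @chart K n T r th io, w !=set0,
      forall x y, w x -> w y <-> exists2 u, Gm K r u & y = (io u * x)%g &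
      forall x u, w x -> Gm K r u -> (x * io u = io (gm (Phi T r w) u) * x)%g].
Proof.
have [th0 [io0 ch0]] := chart_exists hr.
case: hw => g [_ Tg] wgT.
have Tconj t : T t -> T (g * t * g^-1)%g.
  by rewrite -{1}Tg => -[t1 Tt1 <-]; rewrite conjgE !mulgA mulgV mul1g mulgK.
have TconjV t : T t -> T (g^-1 * t * g)%g.
  by move=> Tt; rewrite -Tg; exists t => //; rewrite conjgE mulgA.
have wx0 : w (xget 1%g w).
  apply: (xgetPex 1%g); exists g; rewrite -wgT; exists 1%g; rewrite ?mulg1 //.
  exact: (chart_T1 ch0).
have wconj x t : w x -> T t -> (x * t * x^-1 = g * t * g^-1)%g.
  rewrite -wgT => -[s Ts <-] Tt; rewrite invgM !mulgA -(mulgA g).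
  by rewrite (chart_mulTC ch0 Ts Tt) mulgA mulgK.
have phiE x t : w x -> T t -> phi w t = (x * t * x^-1)%g.
  by move=> wx Tt; rewrite /phi !wconj.
have phiT t : T t -> T (phi w t).
  by move=> Tt; rewrite (phiE _ _ wx0) // wconj //; exact: Tconj.
have [th [io [ch phio]]] := Phi_chart hr phiT.
exists th, io; split=> //; first by exists (xget 1%g w).
  move=> x y wx; split=> [wy|[u Gu ->]].
    have Tyx : T (y * x^-1)%g.
      move: wy wx; rewrite -wgT => -[s Ts <-] [t Tt <-].
      rewrite invgM mulgA -(mulgA g); apply: Tconj.
      by apply: (chart_mulT ch) => //; exact: (chart_TV ch).
    exists (th (y * x^-1)%g); first exact: (chart_Gm ch).
    by rewrite (chartK ch) // mulgVK.
  have Tu := chart_mem ch Gu.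
  move: wx; rewrite -wgT => -[t Tt <-]; exists (g^-1 * io u * g * t)%g.
    by apply: (chart_mulT ch) => //; exact: TconjV.
  by rewrite !mulgA mulgV mul1g.
move=> x u wx Gu; rewrite -phio // (phiE x) //; last exact: (chart_mem ch).
by rewrite mulgVK.
Qed.

End WeylComponent.

Local Close Scope ring_scope.
Local Close Scope classical_set_scope.

Theorem theorem1 (K : closedFieldType) (n r : nat) (G T w : set (GL K n))
  (hG : connected_semisimple G) (hT : maximal_torus G T)
  (hr : torus_of_dim r T) (hw : weyl G T w) (k : nat) (hk : 0 < k) :
  [/\ ~~ (min_order w %| k) -> elts_of_order k w = set0,
      forall s : nat,
        min_order w = order_weyl T w -> k = min_order w * s ->
        orbit_decomposition T w (elts_of_order k w)
          (multiplicity T r w * nu K s (sigma T r w)) (r - sigma T r w)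
    & forall s : nat,
        min_order w = 2 * order_weyl T w -> k = min_order w * s ->
        orbit_decomposition T w (elts_of_order k w)
          (multiplicity T r w *
             (if odd s then nu K s (sigma T r w) + nu K (2 * s) (sigma T r w)
              else nu K (2 * s) (sigma T r w)))
          (r - sigma T r w)].
Proof.
have [th [io [ch w0 wE wconj]]] := weyl_chart hr hw.
split=> [|s|s].
- exact: (min_order_dvd ch wE wconj hk).
- exact: (decomposition_split ch w0 wE wconj hk).
- exact: (decomposition_twisted ch w0 wE wconj hk).
Qed.
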